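(* If $\mathrm{ZF}$ is consistent, then $\mathrm{ZFU}$ + Plenitude + $\mathrm{SVC}$ does not prove the Collection Principle.
   Context: $\mathrm{ZFU}$ is ZF set theory with urelements. Its language has $\in$ and a unary predicate $\mathscr{A}$ for urelements; $\mathscr{A}$ also denotes the class of all urelements. A set is an object that is not an urelement. The axioms are Foundation, Pairing, Union, Powerset, Infinity, the Separation schema, the Replacement schema (but not Collection), Extensionality for sets only, and the axiom that no urelement has members. The urelements may form a proper class. $x\preceq^* y$ means that there is a surjection from $y$ onto $x$ or $x=\emptyset$. Ordinals are transitive sets with no urelements in their transitive closure, well-ordered by $\in$. Plenitude: for every ordinal $\alpha$ there is a set of urelements equinumerous to $\alpha$. $\mathrm{SVC}(S)$, for a set $S$: for every set $x$ there is an ordinal $\alpha$ such that $x\preceq^* S\times\alpha$. $\mathrm{SVC}$ (Small Violations of Choice): there is a set $S$ such that $\mathrm{SVC}(S)$. Collection (schema, for each formula $\varphi$): $\forall w,u\,(\forall x\in w\,\exists y\,\varphi(x,y,u)\to\exists v\,\forall x\in w\,\exists y\in v\,\varphi(x,y,u))$. ''Does not prove Collection'' means that some instance of the schema is not provable. *)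

(* Defs.v *)
(* Written over the Rocq standard library. *)
From Stdlib Require Import Arith List.

Set Implicit Arguments.

(** First-order logic with equality, a binary predicate and unary predicates indexed by [P].
    The only terms are variables, written as de Bruijn indices: under [All], the index 0 is
    the bound variable and [S i] is the variable called [i] outside the quantifier.
    [P := Empty_set] gives the language of ZF and [P := unit] that of ZFU. *)

Inductive form (P : Type) : Type :=
| Bot : form P
| Eq : nat -> nat -> form P
| Mem : nat -> nat -> form P
| Pred : P -> nat -> form P
| Imp : form P -> form P -> form P
| All : form P -> form P.

Arguments Bot {P}.
Arguments Eq {P} _ _.
Arguments Mem {P} _ _.

Declare Scope form_scope.
Delimit Scope form_scope with form.
Bind Scope form_scope with form.
Local Open Scope form_scope.

Definition Neg {P} (a : form P) := Imp a Bot.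
Definition Or {P} (a b : form P) := Imp (Neg a) b.
Definition And {P} (a b : form P) := Neg (Imp a (Neg b)).
Definition Iff {P} (a b : form P) := And (Imp a b) (Imp b a).
Definition Ex {P} (a : form P) := Neg (All (Neg a)).

Notation "x ≡ y" := (Eq x%nat y%nat) (at level 70, no associativity) : form_scope.
Notation "x ∈ y" := (Mem x%nat y%nat) (at level 70, no associativity) : form_scope.
Notation "¬ a" := (Neg a) (at level 75, right associativity) : form_scope.
Notation "a ∧ b" := (And a b) (at level 80, right associativity) : form_scope.
Notation "a ∨ b" := (Or a b) (at level 85, right associativity) : form_scope.
Notation "a ⇔ b" := (Iff a b) (at level 95, no associativity) : form_scope.
Notation "a ⇒ b" := (Imp a b) (at level 99, b at level 200, right associativity) : form_scope.

Definition lift (r : nat -> nat) (i : nat) : nat :=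
  match i with 0 => 0 | S j => S (r j) end.

Fixpoint ren {P} (r : nat -> nat) (a : form P) : form P :=
  match a with
  | Bot => Bot
  | Eq x y => Eq (r x) (r y)
  | Mem x y => Mem (r x) (r y)
  | Pred p x => Pred p (r x)
  | Imp a b => Imp (ren r a) (ren r b)
  | All a => All (ren (lift r) a)
  end.

(** [inst x a] substitutes [x] for the variable 0 of [a] and removes that variable. *)
Definition inst {P} (x : nat) : form P -> form P :=
  ren (fun i => match i with 0 => x | S j => j end).

(** [weaken k m a] inserts [m] variables not occurring in [a], with indices k, ..., k + m - 1. *)
Definition weaken {P} (k m : nat) : form P -> form P :=
  ren (fun i => if i <? k then i else m + i).

(** [bounded n a]: the free variables of [a] are among 0, ..., n - 1. *)
Fixpoint bounded {P} (n : nat) (a : form P) : Prop :=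
  match a with
  | Bot => True
  | Eq x y => x < n /\ y < n
  | Mem x y => x < n /\ y < n
  | Pred _ x => x < n
  | Imp a b => bounded n a /\ bounded n b
  | All a => bounded (S n) a
  end.

Fixpoint alls {P} (n : nat) (a : form P) : form P :=
  match n with 0 => a | S m => All (alls m a) end.

Inductive prv {P} : list (form P) -> form P -> Prop :=
| prv_ctx G a : In a G -> prv G a
| prv_impI G a b : prv (a :: G) b -> prv G (a ⇒ b)
| prv_impE G a b : prv G (a ⇒ b) -> prv G a -> prv G b
| prv_dne G a : prv G (¬ ¬ a) -> prv G a
| prv_allI G a : prv (map (ren S) G) a -> prv G (All a)
| prv_allE G a x : prv G (All a) -> prv G (inst x a)
| prv_refl G x : prv G (x ≡ x)
| prv_leibniz G a x y : prv G (x ≡ y) -> prv G (inst x a) -> prv G (inst y a).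

Definition theory (P : Type) := form P -> Prop.

Definition provable {P} (T : theory P) (a : form P) : Prop :=
  exists G, (forall b, In b G -> T b) /\ prv G a.

Definition consistent {P} (T : theory P) : Prop := ~ provable T Bot.

Section Common.
Context {P : Type}.
Implicit Types (a : form P) (x y z f w : nat).

(** Bounded quantifiers: [x] is read outside the quantifier, [a] inside it. *)
Definition AllIn x a : form P := All (0 ∈ S x ⇒ a).
Definition ExIn x a : form P := Ex (0 ∈ S x ∧ a).

(** There is exactly one value of the variable 0 satisfying [a]:
    some [c] is such that, for all [b], [a(b)] iff [b = c]. *)
Definition ExUniq a : form P := Ex (All (weaken 1 1 a ⇔ 0 ≡ 1)).

Definition sub x y : form P := All (0 ∈ S x ⇒ 0 ∈ S y).
Definition empty x : form P := All (¬ 0 ∈ S x).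
Definition is_transitive x : form P := AllIn x (sub 0 (S x)).

(** z = {x, y} *)
Definition upair z x y : form P := All (0 ∈ S z ⇔ (0 ≡ S x ∨ 0 ≡ S y)).
(** z = {{x}, {x, y}} *)
Definition opair z x y : form P :=
  Ex (Ex (upair 1 (2 + x) (2 + x) ∧ upair 0 (2 + x) (2 + y) ∧ upair (2 + z) 1 0)).
(** (x, y) ∈ f *)
Definition pair_in f x y : form P := ExIn f (opair 0 (S x) (S y)).
(** y = x ∪ {x} *)
Definition succ y x : form P := All (0 ∈ S y ⇔ (0 ∈ S x ∨ 0 ≡ S x)).

(** The formulations of Foundation, Pairing, Replacement and Collection are the same with and
    without urelements. *)

Definition foundation : form P :=
  All (Ex (0 ∈ 1) ⇒ ExIn 0 (¬ ExIn 1 (0 ∈ 1))).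

Definition pairing : form P := All (All (Ex (upair 0 2 1))).

(** In the schemas, the formula is [a(x, y, u_0, ..., u_(n-1))] with y = 0, x = 1, u_i = 2 + i.
    The parameters u are quantified universally, outermost. *)

Definition replacement n a : form P :=
  alls n (All (AllIn 0 (ExUniq (weaken 2 1 a))
               ⇒ Ex (AllIn 1 (ExIn 1 (weaken 2 2 a))))).

Definition collection n a : form P :=
  alls n (All (AllIn 0 (Ex (weaken 2 1 a))
               ⇒ Ex (AllIn 1 (ExIn 1 (weaken 2 2 a))))).

Inductive Collection : theory P :=
| Collection_instance n a : bounded (2 + n) a -> Collection (collection n a).

End Common.

Module zf.

Notation zform := (form Empty_set).

Definition extensionality : zform :=
  All (All (All (0 ∈ 2 ⇔ 0 ∈ 1) ⇒ 1 ≡ 0)).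

Definition union : zform := All (Ex (All (0 ∈ 1 ⇔ ExIn 2 (1 ∈ 0)))).

Definition powerset : zform := All (Ex (All (0 ∈ 1 ⇔ sub 0 2))).

Definition infinity : zform :=
  Ex (ExIn 0 (empty 0) ∧ AllIn 0 (ExIn 1 (succ 0 1))).

(** The formula is [a(x, u_0, ..., u_(n-1))] with x = 0 and u_i = 1 + i. *)
Definition separation n (a : zform) : zform :=
  alls n (All (Ex (All (0 ∈ 1 ⇔ (0 ∈ 2 ∧ weaken 1 2 a))))).

End zf.

Inductive ZF : theory Empty_set :=
| ZF_ext : ZF zf.extensionality
| ZF_found : ZF foundation
| ZF_pair : ZF pairing
| ZF_union : ZF zf.union
| ZF_power : ZF zf.powerset
| ZF_inf : ZF zf.infinity
| ZF_sep n a : bounded (1 + n) a -> ZF (zf.separation n a)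
| ZF_repl n a : bounded (2 + n) a -> ZF (replacement n a).

Module zfu.

Notation uform := (form unit).

Definition Ur (x : nat) : uform := Pred tt x.
Definition isSet (x : nat) : uform := ¬ Ur x.
Definition ExSet (a : uform) : uform := Ex (isSet 0 ∧ a).

Definition extensionality : uform :=
  All (All (isSet 1 ∧ isSet 0 ⇒ All (0 ∈ 2 ⇔ 0 ∈ 1) ⇒ 1 ≡ 0)).

Definition urelements_empty : uform := All (Ur 0 ⇒ empty 0).

Definition union : uform := All (ExSet (All (0 ∈ 1 ⇔ ExIn 2 (1 ∈ 0)))).

(** The powerset contains only sets, although every urelement is vacuously included in
    every object. *)
Definition powerset : uform := All (ExSet (All (0 ∈ 1 ⇔ (isSet 0 ∧ sub 0 2)))).

Definition infinity : uform :=
  ExSet (ExIn 0 (isSet 0 ∧ empty 0) ∧ AllIn 0 (ExIn 1 (succ 0 1))).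

Definition separation n (a : uform) : uform :=
  alls n (All (ExSet (All (0 ∈ 1 ⇔ (0 ∈ 2 ∧ weaken 1 2 a))))).

(** x belongs to the transitive closure of y, i.e. to every transitive set including y *)
Definition in_trcl x y : uform :=
  All (isSet 0 ∧ is_transitive 0 ∧ sub (S y) 0 ⇒ S x ∈ 0).

(** a is strictly linearly ordered by ∈, and its nonempty subsets have a least element *)
Definition well_ordered a : uform :=
  AllIn a (¬ 0 ∈ 0)
  ∧ AllIn a (AllIn (1 + a) (AllIn (2 + a) (2 ∈ 1 ⇒ 1 ∈ 0 ⇒ 2 ∈ 0)))
  ∧ AllIn a (AllIn (1 + a) (1 ∈ 0 ∨ 1 ≡ 0 ∨ 0 ∈ 1))
  ∧ All (sub 0 (S a) ∧ Ex (0 ∈ 1) ⇒ ExIn 0 (AllIn 1 (1 ≡ 0 ∨ 1 ∈ 0))).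

Definition ordinal a : uform :=
  isSet a ∧ is_transitive a ∧ All (Ur 0 ⇒ ¬ in_trcl 0 (S a)) ∧ well_ordered a.

(** f is a function from x to y *)
Definition func f x y : uform :=
  isSet f
  ∧ AllIn f (ExIn (1 + x) (ExIn (2 + y) (opair 2 1 0)))
  ∧ AllIn x (ExUniq (pair_in (2 + f) 1 0)).

Definition surjection f x y : uform :=
  func f x y ∧ AllIn y (ExIn (1 + x) (pair_in (2 + f) 0 1)).

Definition injection f x y : uform :=
  func f x y
  ∧ AllIn x (AllIn (1 + x) (AllIn (2 + y) (pair_in (3 + f) 2 0 ⇒ pair_in (3 + f) 1 0 ⇒ 2 ≡ 1))).

Definition equinumerous x y : uform :=
  Ex (injection 0 (S x) (S y) ∧ surjection 0 (S x) (S y)).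

(** x ⪯* y *)
Definition surj_le x y : uform :=
  Ex (surjection 0 (S y) (S x)) ∨ (isSet x ∧ empty x).

(** p = x × y *)
Definition product p x y : uform :=
  isSet p ∧ All (0 ∈ S p ⇔ ExIn (1 + x) (ExIn (2 + y) (opair 2 1 0))).

Definition plenitude : uform :=
  All (ordinal 0 ⇒ ExSet (AllIn 0 (Ur 0) ∧ equinumerous 0 1)).

Definition svc_of s : uform :=
  All (isSet 0 ⇒ Ex (ordinal 0 ∧ Ex (product 0 (3 + s) 1 ∧ surj_le 2 0))).

Definition svc : uform := ExSet (svc_of 0).

End zfu.

Inductive ZFU : theory unit :=
| ZFU_ext : ZFU zfu.extensionality
| ZFU_ur : ZFU zfu.urelements_empty
| ZFU_found : ZFU foundation
| ZFU_pair : ZFU pairing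
| ZFU_union : ZFU zfu.union
| ZFU_power : ZFU zfu.powerset
| ZFU_inf : ZFU zfu.infinity
| ZFU_sep n a : bounded (1 + n) a -> ZFU (zfu.separation n a)
| ZFU_repl n a : bounded (2 + n) a -> ZFU (replacement n a).

Inductive ZFU_Plenitude_SVC : theory unit :=
| ZPS_ZFU a : ZFU a -> ZFU_Plenitude_SVC a
| ZPS_plenitude : ZFU_Plenitude_SVC zfu.plenitude
| ZPS_SVC : ZFU_Plenitude_SVC zfu.svc.

(* Main.v *)
Require Import Defs.
From Stdlib Require Import Arith List Lia Classical ClassicalEpsilon.
From Stdlib Require Import FunctionalExtensionality PropExtensionality ProofIrrelevance.
From Stdlib Require Import Setoid.
From mathcomp Require boolp wochoice.

Set Implicit Arguments.
Unset Strict Implicit.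

(** The proof exhibits a model of ZFU, Plenitude and SVC in which one instance of Collection fails;
    soundness of the calculus ([soundness]) then gives the theorem.

    The ambient universe consists of well-founded trees branching over the types of a fixed universe
    [small], with leaves from a proper class of atoms; this is Aczel's reading of sets in type
    theory. There are block atoms [Blk i d], with [i] in the proper class [Idx] and [d] a natural
    number, and plain atoms [Pln j] with [j] in [Idx]. A pair of permutations, one of [Idx] and one
    of [nat], acts on the two coordinates of the block atoms and fixes the plain atoms. The model
    [V] is the Fraenkel-Mostowski model of this action: the trees that, hereditarily, are fixed by
    all pairs fixing the members of a finite [K] in [Idx] and of a finite [E] in [nat], taken up to
    extensional equality.

    The pairs act on [V] by automorphisms, so a definable class is invariant under all pairs that
    fix its parameters. If it also has only a small family of members, then it is a set of the model
    ([comprehension]); most axioms of ZFU follow, Replacement because the image of a small family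
    under a class function is small. Collection would demand more: a choice of witnesses may be
    small but not invariant.

    Plenitude holds because plain atoms are fixed by everything and each small type embeds in [Idx].

    The fact behind SVC and behind the failure of Collection is [occ_support]: the blocks from
    which a set takes atoms all belong to the finite [K] of any support of that set. Otherwise
    such a block could be swapped with one that does not occur, which exists since [Idx] is not
    small.

    For SVC, let [K] be the index part of a support of a nonempty set [x]. A permutation of the
    indices that fixes [K] does nothing to the members of [x], so each member is supported by [K]
    and some finite tuple of naturals ([member_support]). Well-order the members of [x] from
    outside. Send a tuple [e] and the position of a member [y] to the translate of [y] by any pair
    that fixes a support of [x] and takes a supporting tuple of [y] to [e], and to a fixed member
    if there is no such pair. This is a function of the model, so [x] is an image of the set of
    tuples times an ordinal ([surjection_from_tuples]), and the set of tuples does not depend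
    on [x].

    The instance of Collection that fails says: if every member of [w] injects into a set of
    urelements, then some set [v] contains, for every member of [w], such a target. Let [w] consist,
    for all [n], of the disjoint union of [n] copies of a block. This union injects into the union
    of any [n] blocks. Conversely, an injection of it into urelements has a finite support, and for
    [d] outside that support it must send the [d]-th element of every copy to the [d]-th atom of
    some block ([injection_diagonal]), so it uses at least [n] blocks. But all the members of [v]
    together use only the finitely many blocks in a support of [v] ([blocks_needed]). *)

(** * Indices and permutations *)

(** The name fixes one universe level: the trees below branch over types of this level, and [Idx]
    and the type of trees live above it. *)
Definition small := Type.

(** A type that is too large to be small, although every small type embeds in it: a subset [p]
    of a small type [A] serves as an index tagged by [A]. *)
Definition Idx : Type := {A : small & A -> Prop}.

Lemma existT_inj (A : small) (p q : A -> Prop) :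
  existT (fun A : small => A -> Prop) A p = existT _ A q -> p = q.
Proof. apply ProofIrrelevanceTheory.EqdepTheory.inj_pair2. Qed.

(** Cantor's diagonal argument, with the subsets of [A] itself. *)
Lemma Idx_not_small (A : small) (f : A -> Idx) : exists i, forall a, f a <> i.
Proof.
  set (p := fun a => ~ exists q, f a = existT _ A q /\ q a).
  exists (existT _ A p). intros a e.
  assert (n : ~ p a).
  { intro h. apply h. exists p. auto. }
  apply NNPP in n. destruct n as [q [e' h]].
  rewrite e in e'. apply existT_inj in e'. subst q.
  apply h. exists p. split; assumption.
Qed.

Lemma Idx_embeds_small (A : small) :
  exists f : A -> Idx, forall a b, f a = f b -> a = b.
Proof.
  exists (fun a => existT _ A (eq a)). intros a b e.
  apply existT_inj in e. rewrite e. reflexivity.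
Qed.

Record bij (T : Type) := Bij {
  fwd :> T -> T;
  bwd : T -> T;
  fwdK : forall x, bwd (fwd x) = x;
  bwdK : forall x, fwd (bwd x) = x }.

Definition inv T (g : bij T) : bij T :=
  {| fwd := bwd g; bwd := fwd g; fwdK := bwdK g; bwdK := fwdK g |}.

Definition idb T : bij T :=
  {| fwd := fun x => x; bwd := fun x => x;
     fwdK := fun x => eq_refl; bwdK := fun x => eq_refl |}.

Program Definition comp T (g h : bij T) : bij T :=
  {| fwd := fun x => g (h x); bwd := fun x => bwd h (bwd g x) |}.
Next Obligation. rewrite fwdK. apply fwdK. Qed.
Next Obligation. rewrite bwdK. apply bwdK. Qed.

Definition swapf T (x y z : T) : T :=
  if excluded_middle_informative (z = x) then y
  else if excluded_middle_informative (z = y) then x else z.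

Lemma swapfK T (x y z : T) : swapf x y (swapf x y z) = z.
Proof.
  unfold swapf.
  destruct (excluded_middle_informative (z = x)); [subst|].
  - destruct (excluded_middle_informative (y = x)); [congruence|].
    destruct (excluded_middle_informative (y = y)); congruence.
  - destruct (excluded_middle_informative (z = y)); [subst|].
    + destruct (excluded_middle_informative (x = x)); congruence.
    + destruct (excluded_middle_informative (z = x)); [congruence|].
      destruct (excluded_middle_informative (z = y)); congruence.
Qed.

Definition swap T (x y : T) : bij T :=
  {| fwd := swapf x y; bwd := swapf x y; fwdK := swapfK x y; bwdK := swapfK x y |}.

Lemma swap_l T (x y : T) : swap x y x = y.
Proof. cbn; unfold swapf. destruct (excluded_middle_informative (x = x)); congruence. Qed.

Lemma swap_other T (x y z : T) : z <> x -> z <> y -> swap x y z = z.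
Proof.
  cbn; unfold swapf. intros.
  destruct (excluded_middle_informative (z = x)); [congruence|].
  destruct (excluded_middle_informative (z = y)); congruence.
Qed.

Definition perm : Type := (bij Idx * bij nat)%type.
Definition pinv (g : perm) : perm := (inv (fst g), inv (snd g)).
Definition pcomp (g h : perm) : perm := (comp (fst g) (fst h), comp (snd g) (snd h)).

Definition fixes (K : list Idx) (E : list nat) (g : perm) : Prop :=
  (forall i, In i K -> fst g i = i) /\ (forall d, In d E -> snd g d = d).

Lemma fixes_inv K E g : fixes K E g -> fixes K E (pinv g).
Proof.
  intros [h1 h2]; split; intros i hi; cbn.
  - rewrite <- (h1 i hi) at 1. apply fwdK.
  - rewrite <- (h2 i hi) at 1. apply fwdK.
Qed.

Lemma fixes_app K L E F g : fixes (K ++ L) (E ++ F) g <-> fixes K E g /\ fixes L F g.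
Proof.
  unfold fixes. split.
  - intros [h1 h2]. repeat split; intros; first [apply h1 | apply h2]; apply in_or_app; auto.
  - intros [[h1 h2] [h3 h4]]. split; intros x hx; apply in_app_or in hx; destruct hx; auto.
Qed.

Inductive atom : Type := Blk (i : Idx) (d : nat) | Pln (j : Idx).

Definition aact (g : perm) (a : atom) : atom :=
  match a with Blk i d => Blk (fst g i) (snd g d) | Pln j => Pln j end.

(** * Trees and their symmetries *)

Inductive tree : Type := atm (a : atom) | sup (A : small) (f : A -> tree).
Arguments sup {A} f.

(** Extensional equality: each child of one tree has an equal child in the other. *)
Fixpoint eqt (x y : tree) : Prop :=
  match x, y with
  | atm a, atm b => a = b
  | @sup _ f, @sup _ g =>
    (forall a, exists b, eqt (f a) (g b)) /\ (forall b, exists a, eqt (f a) (g b))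
  | _, _ => False
  end.

Lemma eqt_refl x : eqt x x.
Proof. induction x; cbn; eauto. Qed.

Lemma eqt_sym x : forall y, eqt x y -> eqt y x.
Proof.
  induction x as [a|A f IH]; intros [b|B g]; cbn; auto.
  intros [h1 h2]. split; intro c; [destruct (h2 c) as [d]|destruct (h1 c) as [d]]; eauto.
Qed.

Lemma eqt_trans x : forall y z, eqt x y -> eqt y z -> eqt x z.
Proof.
  induction x as [a|A f IH]; intros [b|B g] [c|C k]; cbn; try tauto; try congruence.
  intros [h1 h2] [h3 h4]. split.
  - intro a. destruct (h1 a) as [b hb]. destruct (h3 b) as [c hc]. eauto.
  - intro c. destruct (h4 c) as [b hb]. destruct (h2 b) as [a ha]. eauto.
Qed.

Definition memt (x y : tree) : Prop :=
  match y with atm _ => False | @sup _ f => exists a, eqt x (f a) end.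

Lemma memt_eqt x y z : eqt y z -> memt x y -> memt x z.
Proof.
  destruct y as [b|B g], z as [c|C k]; cbn; try tauto.
  intros [h _] [b hb]. destruct (h b) as [c hc]. eauto using eqt_trans.
Qed.

Fixpoint actt (g : perm) (x : tree) : tree :=
  match x with
  | atm a => atm (aact g a)
  | @sup _ f => sup (fun a => actt g (f a))
  end.

Lemma actt_eqt g x : forall y, eqt x y -> eqt (actt g x) (actt g y).
Proof.
  induction x as [a|A f IH]; intros [b|B k]; cbn; try tauto; try congruence.
  intros [h1 h2]. split; intro c; [destruct (h1 c)|destruct (h2 c)]; eauto.
Qed.

Lemma actt_comp g h x : actt (pcomp g h) x = actt g (actt h x).
Proof.
  induction x as [[i d|j]|A f IH]; cbn; try reflexivity.
  f_equal. extensionality a. apply IH.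
Qed.

Lemma actt_id (g : perm) x : (forall i, fst g i = i) -> (forall d, snd g d = d) -> actt g x = x.
Proof.
  intros h1 h2. induction x as [[i d|j]|A f IH]; cbn; try reflexivity.
  - rewrite h1, h2. reflexivity.
  - f_equal. extensionality a. apply IH.
Qed.

Lemma acttVK g x : actt g (actt (pinv g) x) = x.
Proof. rewrite <- actt_comp. apply actt_id; intro; cbn; apply bwdK. Qed.

Lemma actt_memt g x y : memt x y -> memt (actt g x) (actt g y).
Proof.
  destruct y as [b|B k]; cbn; auto. intros [a ha]. exists a. apply actt_eqt, ha.
Qed.

Definition symmetric (x : tree) : Prop :=
  exists K E, forall g, fixes K E g -> eqt (actt g x) x.

Fixpoint hereditary (x : tree) : Prop :=
  symmetric x /\ match x with atm _ => True | @sup _ f => forall a, hereditary (f a) end.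

Lemma hereditary_symmetric x : hereditary x -> symmetric x.
Proof. destruct x; cbn; tauto. Qed.

Lemma symmetric_eqt x y : eqt x y -> symmetric x -> symmetric y.
Proof.
  intros e (K & E & h). exists K, E. intros g hg.
  apply eqt_trans with (actt g x); [apply actt_eqt, eqt_sym, e|].
  apply eqt_trans with x; auto.
Qed.

Lemma hereditary_eqt x : forall y, eqt x y -> hereditary x -> hereditary y.
Proof.
  induction x as [a|A f IH]; intros [b|B g] e hx.
  - cbn in e; subst; assumption.
  - destruct e.
  - destruct e.
  - split; [apply symmetric_eqt with (1 := e), hereditary_symmetric, hx|].
    intro b. destruct e as [_ e]. destruct (e b) as [a ha]. apply IH with (1 := ha). apply hx.
Qed.

Lemma hereditary_memt x y : hereditary y -> memt x y -> hereditary x.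
Proof.
  destruct y as [b|B k]; cbn; [tauto|].
  intros [_ h] [b hb]. apply hereditary_eqt with (1 := eqt_sym hb), h.
Qed.

(** A support of [x] is carried by [g] to a support of the translate: conjugate by [g]. *)
Lemma symmetric_actt g x : symmetric x -> symmetric (actt g x).
Proof.
  intros (K & E & h). exists (map (fst g) K), (map (snd g) E). intros k [h1 h2].
  assert (hk : fixes K E (pcomp (pinv g) (pcomp k g))).
  { split; cbn; intros i hi.
    - rewrite h1 by (apply in_map, hi). apply fwdK.
    - rewrite h2 by (apply in_map, hi). apply fwdK. }
  apply h in hk. rewrite !actt_comp in hk.
  apply (actt_eqt g) in hk. rewrite acttVK in hk. exact hk.
Qed.

Lemma hereditary_actt g x : hereditary x -> hereditary (actt g x).
Proof.
  intro h. assert (hs := symmetric_actt g (hereditary_symmetric h)).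
  induction x as [a|A f IH]; split; auto.
  intro a. destruct h as [_ h]. apply IH; [apply h|]. apply symmetric_actt, hereditary_symmetric, h.
Qed.

(** * The model as an extensional structure *)

Definition canon (x : tree) : tree := epsilon (inhabits x) (eqt x).

Lemma eqt_canon x : eqt x (canon x).
Proof. unfold canon. apply epsilon_spec. exists x. apply eqt_refl. Qed.

Lemma canon_eqt x y : eqt x y -> canon x = canon y.
Proof.
  intro e. unfold canon.
  assert (h : eqt x = eqt y).
  { extensionality z. apply propositional_extensionality.
    split; intro; eauto using eqt_trans, eqt_sym. }
  rewrite h. f_equal. apply proof_irrelevance.
Qed.

(** One chosen tree from each class of [eqt], so that extensional equality becomes equality. *)
Definition V : Type := {x : tree | hereditary x /\ canon x = x}.
Definition rep (x : V) : tree := proj1_sig x.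

Lemma rep_hereditary x : hereditary (rep x).
Proof. apply (proj2_sig x). Qed.

(** The class of an arbitrary hereditarily symmetric tree. *)
Definition toV (x : tree) (h : hereditary x) : V :=
  exist _ (canon x)
    (conj (hereditary_eqt (eqt_canon x) h) (eq_sym (canon_eqt (eqt_canon x)))).

Lemma rep_toV x (h : hereditary x) : eqt x (rep (toV h)).
Proof. apply eqt_canon. Qed.

Lemma V_eq x y : eqt (rep x) (rep y) -> x = y.
Proof.
  destruct x as [x [hx ex]], y as [y [hy ey]]. cbn. intro e.
  assert (x = y) by (rewrite <- ex, <- ey; apply canon_eqt, e).
  subst y. f_equal. apply proof_irrelevance.
Qed.

Definition mem (x y : V) : Prop := memt (rep x) (rep y).
Definition ur (x : V) : Prop := exists a, rep x = atm a.
Definition act (g : perm) (x : V) : V := toV (hereditary_actt g (rep_hereditary x)).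

Lemma rep_act g x : eqt (actt g (rep x)) (rep (act g x)).
Proof. apply rep_toV. Qed.

Lemma act_comp g h x : act (pcomp g h) x = act g (act h x).
Proof.
  apply V_eq. apply eqt_trans with (actt g (actt h (rep x))).
  - rewrite <- actt_comp. apply eqt_sym, rep_act.
  - apply eqt_trans with (actt g (rep (act h x))); [apply actt_eqt, rep_act|apply rep_act].
Qed.

Lemma act_id (g : perm) x : (forall i, fst g i = i) -> (forall d, snd g d = d) -> act g x = x.
Proof.
  intros h1 h2. apply V_eq, eqt_sym. rewrite <- (actt_id (rep x) h1 h2) at 1. apply rep_act.
Qed.

Lemma actK g x : act (pinv g) (act g x) = x.
Proof. rewrite <- act_comp. apply act_id; intro; cbn; apply fwdK. Qed.

Lemma actVK g x : act g (act (pinv g) x) = x.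
Proof. rewrite <- act_comp. apply act_id; intro; cbn; apply bwdK. Qed.

Lemma act_inj g x y : act g x = act g y -> x = y.
Proof. intro e. rewrite <- (actK g x), e. apply actK. Qed.

Lemma act_mem g x y : mem (act g x) (act g y) <-> mem x y.
Proof.
  assert (H : forall g x y, mem x y -> mem (act g x) (act g y)).
  { clear. intros g x y h. apply (actt_memt g) in h.
    apply (memt_eqt (rep_act g y)) in h. unfold mem.
    revert h. destruct (rep (act g y)); cbn; auto.
    intros [a ha]. exists a. apply eqt_trans with (actt g (rep x)); auto. apply eqt_sym, rep_act. }
  split; [|apply H]. intro h. apply (H (pinv g)) in h. rewrite !actK in h. exact h.
Qed.

Lemma act_ur g x : ur (act g x) <-> ur x.
Proof.
  assert (H : forall g x, ur x -> ur (act g x)).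
  { clear. intros g x [a ha]. exists (aact g a).
    assert (h := rep_act g x). rewrite ha in h.
    destruct (rep (act g x)); [f_equal; symmetry; exact h|destruct h]. }
  split; [|apply H]. intro h. apply (H (pinv g)) in h. rewrite actK in h. exact h.
Qed.

Lemma hereditary_atm a : hereditary (atm a).
Proof.
  split; [|exact I]. destruct a as [i d|j].
  - exists (i :: nil), (d :: nil). intros g [h1 h2]. cbn. rewrite h1, h2; cbn; auto.
  - exists nil, nil. intros g _. reflexivity.
Qed.

Definition of_atom (a : atom) : V := toV (hereditary_atm a).

Lemma rep_of_atom a : rep (of_atom a) = atm a.
Proof.
  assert (h := rep_toV (hereditary_atm a)). unfold of_atom.
  destruct (rep (toV (hereditary_atm a))); [cbn in h; congruence|destruct h].
Qed.

Lemma of_atom_inj a b : of_atom a = of_atom b -> a = b.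
Proof. intro e. apply (f_equal rep) in e. rewrite !rep_of_atom in e. congruence. Qed.

Lemma of_atom_ur a : ur (of_atom a).
Proof. exists a. apply rep_of_atom. Qed.

Lemma ur_of_atom x : ur x -> exists a, x = of_atom a.
Proof. intros [a ha]. exists a. apply V_eq. rewrite rep_of_atom, ha. reflexivity. Qed.

Lemma act_of_atom g a : act g (of_atom a) = of_atom (aact g a).
Proof.
  apply V_eq. rewrite rep_of_atom. apply eqt_sym.
  assert (h := rep_act g (of_atom a)). rewrite rep_of_atom in h. exact h.
Qed.

Lemma ur_empty x y : ur x -> ~ mem y x.
Proof. intros [a ha]. unfold mem. rewrite ha. exact (fun f => f). Qed.

Lemma set_ext x y : ~ ur x -> ~ ur y -> (forall z, mem z x <-> mem z y) -> x = y.
Proof.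
  intros hx hy h. apply V_eq. unfold ur in *.
  assert (H : forall t, memt t (rep x) <-> memt t (rep y)).
  { intro t.
    assert (H : forall z : V, eqt t (rep z) -> memt t (rep x) <-> memt t (rep y)).
    { intros z hz.
      assert (G : forall s, memt t s <-> memt (rep z) s).
      { intros [a|A f]; cbn; [tauto|].
        split; intros [a ha]; exists a; eauto using eqt_trans, eqt_sym. }
      rewrite !G. apply h. }
    split; intro ht.
    - apply (H (toV (hereditary_memt (rep_hereditary x) ht))); [apply rep_toV|exact ht].
    - apply (H (toV (hereditary_memt (rep_hereditary y) ht))); [apply rep_toV|exact ht]. }
  destruct (rep x) as [a|A f]; [exfalso; eauto|].
  destruct (rep y) as [b|B k]; [exfalso; eauto|].
  cbn in *. split.
  - intro a. apply H. exists a. apply eqt_refl.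
  - intro b. destruct (proj2 (H (k b))) as [a ha]; [exists b; apply eqt_refl|].
    exists a. apply eqt_sym, ha.
Qed.

Lemma mem_ind (P : V -> Prop) :
  (forall x, (forall y, mem y x -> P y) -> P x) -> forall x, P x.
Proof.
  intros h x. revert x.
  assert (H : forall t (x : V), eqt t (rep x) -> P x).
  { induction t as [a|A f IH]; intros x e; apply h; unfold mem; intros y hy;
      apply (memt_eqt (eqt_sym e)) in hy; [destruct hy|].
    destruct hy as [b hb]. apply (IH b), eqt_sym, hb. }
  intro x. apply (H (rep x)), eqt_refl.
Qed.

Lemma members_small (x : V) :
  exists (A : small) (f : A -> V), forall y, mem y x <-> exists a, f a = y.
Proof.
  destruct x as [x [hx ex]]. unfold mem at 1. cbn. destruct x as [a|A f].
  - exists Empty_set, (fun e : Empty_set => match e with end).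
    cbn. intro y. split; [intros []|intros [[] e]].
  - exists A, (fun a => toV (proj2 hx a)). intro y. cbn. split; intros [a ha]; exists a.
    + apply V_eq, eqt_sym. eapply eqt_trans; [exact ha|apply rep_toV].
    + subst y. apply eqt_sym, rep_toV.
Qed.

Definition supports (K : list Idx) (E : list nat) (x : V) : Prop :=
  forall g, fixes K E g -> act g x = x.

Lemma finite_support x : exists K E, supports K E x.
Proof.
  destruct (hereditary_symmetric (rep_hereditary x)) as (K & E & h). exists K, E. intros g hg.
  apply V_eq. apply eqt_trans with (actt g (rep x)); [apply eqt_sym, rep_act|auto].
Qed.

(** The form in which the model provides sets. Smallness allows the members to be children of one
    tree, and invariance under the pairs fixing [K] and [E] makes that tree symmetric. *)
Lemma comprehension (P : V -> Prop) :
  (exists (A : small) (f : A -> V), forall x, P x -> exists a, f a = x) ->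
  (exists K E, forall g, fixes K E g -> forall x, P x -> P (act g x)) ->
  exists s, ~ ur s /\ forall x, mem x s <-> P x.
Proof.
  intros (A & f & hf) (K & E & hP).
  set (t := @sup {a : A | P (f a)} (fun a => rep (f (proj1_sig a)))).
  assert (ht : forall x, memt (rep x) t <-> P x).
  { intro x. cbn. split.
    - intros [[a ha] e]. cbn in e. apply V_eq in e. subst x. exact ha.
    - intro h. destruct (hf x h) as [a ha]. subst x. exists (exist _ a h). apply eqt_refl. }
  assert (hs : hereditary t).
  { split; [|intro a; apply rep_hereditary]. exists K, E. intros g hg. cbn. split.
    - intros [a ha]. destruct (proj2 (ht (act g (f a)))) as [b hb]; [auto|].
      exists b. cbn. eapply eqt_trans; [apply rep_act|exact hb].
    - intros [b hb]. cbn.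
      destruct (proj2 (ht (act (pinv g) (f b)))) as [a ha]; [apply hP; auto using fixes_inv|].
      exists a. apply (actt_eqt g) in ha. apply eqt_sym. eapply eqt_trans; [|exact ha].
      assert (h := rep_act g (act (pinv g) (f b))). rewrite actVK in h. apply eqt_sym, h. }
  exists (toV hs). split.
  - intros [a ha]. assert (h := rep_toV hs). rewrite ha in h. exact h.
  - intro x. rewrite <- ht. split; apply memt_eqt; [apply eqt_sym|]; apply rep_toV.
Qed.

(** * Satisfaction and soundness *)

Definition scons {M : Type} (x : M) (r : nat -> M) (i : nat) : M :=
  match i with 0 => x | S j => r j end.

Section Satisfaction.
Context {P M : Type} (E : M -> M -> Prop) (U : P -> M -> Prop).

Fixpoint holds (r : nat -> M) (a : form P) : Prop :=
  match a with
  | Bot => False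
  | Eq x y => r x = r y
  | Mem x y => E (r x) (r y)
  | Pred p x => U p (r x)
  | Imp a b => holds r a -> holds r b
  | All a => forall x, holds (scons x r) a
  end.

Lemma holds_ext r s a : (forall i, r i = s i) -> holds r a <-> holds s a.
Proof. intro h. replace s with r; [reflexivity|]. extensionality i. apply h. Qed.

Lemma holds_ren s a : forall r, holds r (ren s a) <-> holds (fun i => r (s i)) a.
Proof.
  revert s. induction a as [|x y|x y|p x|a IHa b IHb|a IH]; intros s r; cbn; try tauto.
  - rewrite IHa, IHb. tauto.
  - assert (H : forall x,
              holds (scons x r) (ren (lift s) a) <-> holds (scons x (fun i => r (s i))) a).
    { intro x. rewrite IH. apply holds_ext. intros [|i]; reflexivity. }
    split; intros h x; apply H, h.
Qed.

Lemma holds_inst r x a : holds r (inst x a) <-> holds (scons (r x) r) a.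
Proof.
  unfold inst. rewrite holds_ren. apply holds_ext. intros [|i]; reflexivity.
Qed.

Lemma holds_bounded a : forall n r s, bounded n a -> (forall i, i < n -> r i = s i) ->
  holds r a <-> holds s a.
Proof.
  induction a as [|x y|x y|p x|a IHa b IHb|a IH]; intros n r s hb h; cbn in *; try tauto.
  - rewrite !h by tauto. tauto.
  - rewrite !h by tauto. tauto.
  - rewrite !h by tauto. tauto.
  - rewrite (IHa n r s), (IHb n r s); tauto.
  - assert (H : forall x, holds (scons x r) a <-> holds (scons x s) a).
    { intro x. apply IH with (1 := hb). intros [|i] hi; cbn; auto with arith. }
    split; intros k x; apply H, k.
Qed.

Lemma soundness G a : prv G a -> forall r, (forall b, In b G -> holds r b) -> holds r a.
Proof.
  induction 1 as [G a h|G a b _ IH|G a b _ IH1 _ IH2|G a _ IH|G a _ IH|G a x _ IH|G x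
                 |G a x y _ IH1 _ IH2]; intros r hG.
  - auto.
  - intro ha. apply IH. intros c [<-|hc]; auto.
  - apply (IH1 r hG), IH2, hG.
  - apply NNPP, (IH r hG).
  - intro x. apply IH. intros c hc. apply in_map_iff in hc. destruct hc as (b & <- & hb).
    apply holds_ren. cbn. exact (hG b hb).
  - apply holds_inst, (IH r hG).
  - reflexivity.
  - apply holds_inst. rewrite <- (IH1 r hG). apply holds_inst, IH2, hG.
Qed.

Lemma holds_alls n a : (forall r, holds r a) -> forall r, holds r (alls n a).
Proof. intro h. induction n; cbn; auto. Qed.

Lemma holds_eq r x y : holds r (Eq x y) <-> r x = r y.
Proof. reflexivity. Qed.
Lemma holds_imp r a b : holds r (Imp a b) <-> (holds r a -> holds r b).
Proof. reflexivity. Qed.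
Lemma holds_all r a : holds r (All a) <-> forall x, holds (scons x r) a.
Proof. reflexivity. Qed.
Lemma holds_neg r a : holds r (Neg a) <-> ~ holds r a.
Proof. reflexivity. Qed.
Lemma holds_or r a b : holds r (Or a b) <-> holds r a \/ holds r b.
Proof. cbn. tauto. Qed.
Lemma holds_and r a b : holds r (And a b) <-> holds r a /\ holds r b.
Proof. cbn. tauto. Qed.
Lemma holds_iff r a b : holds r (Iff a b) <-> (holds r a <-> holds r b).
Proof. cbn. tauto. Qed.
Lemma holds_ex r a : holds r (Ex a) <-> exists x, holds (scons x r) a.
Proof.
  cbn. split.
  - intro h. apply NNPP. intro k. apply h. intros x hx. eauto.
  - intros [x hx] h. exact (h x hx).
Qed.
Lemma holds_AllIn r x a :
  holds r (AllIn x a) <-> forall y, E y (r x) -> holds (scons y r) a.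
Proof. reflexivity. Qed.
Lemma holds_ExIn r x a :
  holds r (ExIn x a) <-> exists y, E y (r x) /\ holds (scons y r) a.
Proof. unfold ExIn. rewrite holds_ex. setoid_rewrite holds_and. reflexivity. Qed.
Lemma holds_ExUniq r a :
  holds r (ExUniq a) <-> exists c, forall b, holds (scons b r) a <-> b = c.
Proof.
  unfold ExUniq. rewrite holds_ex. setoid_rewrite holds_all. setoid_rewrite holds_iff.
  unfold weaken. setoid_rewrite holds_ren. setoid_rewrite holds_eq.
  assert (H : forall b c, (fun i => scons b (scons c r) (if i <? 1 then i else 1 + i)) = scons b r).
  { intros b c. extensionality i. destruct i; reflexivity. }
  setoid_rewrite H. reflexivity.
Qed.

End Satisfaction.

(** * Finite supports and comprehension *)

Lemma common_support (l : list V) :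
  exists K E, forall g, fixes K E g -> forall x, In x l -> act g x = x.
Proof.
  induction l as [|x l (K & E & h)].
  - exists nil, nil. intros g _ x [].
  - destruct (finite_support x) as (K' & E' & h').
    exists (K' ++ K), (E' ++ E). intros g hg. apply fixes_app in hg.
    intros y [<-|hy]; [apply h'|apply h]; tauto.
Qed.

Definition base : Idx := existT (fun A : small => A -> Prop) unit (fun _ => True).

(** Meaningful only when such a set exists; [collect_spec] is the usual reason. *)
Definition collect (P : V -> Prop) : V :=
  epsilon (inhabits (of_atom (Pln base))) (fun s => ~ ur s /\ forall x, mem x s <-> P x).

Lemma collect_eq s P : ~ ur s -> (forall x, mem x s <-> P x) -> collect P = s.
Proof.
  intros hs h.
  destruct (epsilon_spec (inhabits (of_atom (Pln base)))
              (fun s => ~ ur s /\ forall x, mem x s <-> P x)) as [h1 h2]; [eauto|].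
  apply set_ext; auto. intro x. rewrite h. apply h2.
Qed.

Definition is_small (P : V -> Prop) : Prop :=
  exists (A : small) (f : A -> V), forall x, P x -> exists a, f a = x.

Lemma small_sub (P Q : V -> Prop) : (forall x, P x -> Q x) -> is_small Q -> is_small P.
Proof. intros h (A & f & hf). exists A, f. auto. Qed.

Lemma small_eq x : is_small (fun y => y = x).
Proof. exists unit, (fun _ => x). intros y e. exists tt. auto. Qed.

Lemma small_mem x : is_small (fun y => mem y x).
Proof.
  destruct (members_small x) as (A & f & h). exists A, f. intros y hy. apply h, hy.
Qed.

Lemma small_range (A : small) (f : A -> V) : is_small (fun x => exists a, x = f a).
Proof. exists A, f. intros x [a ->]. eauto. Qed.

(** Choice picks a small enumeration of each [Q x]. *)
Lemma small_bigcup (P : V -> Prop) (Q : V -> V -> Prop) :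
  is_small P -> (forall x, P x -> is_small (Q x)) ->
  is_small (fun y => exists x, P x /\ Q x y).
Proof.
  intros (A & f & hf) hQ.
  assert (H : forall a, exists F : {B : small & B -> V},
             P (f a) -> forall y, Q (f a) y -> exists b, projT2 F b = y).
  { intro a. destruct (classic (P (f a))) as [h|h].
    - destruct (hQ _ h) as (B & k & hk). exists (existT _ B k). auto.
    - exists (existT (fun B : small => B -> V) unit (fun _ => f a)). tauto. }
  set (F := fun a => proj1_sig (constructive_indefinite_description _ (H a))).
  exists {a : A & projT1 (F a)}, (fun c => projT2 (F (projT1 c)) (projT2 c)).
  intros y (x & hx & hy). destruct (hf x hx) as [a <-].
  destruct (proj2_sig (constructive_indefinite_description _ (H a)) hx y hy) as [b hb].
  exists (existT _ a b). exact hb.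
Qed.

Lemma small_powerset w : is_small (fun y => ~ ur y /\ forall z, mem z y -> mem z w).
Proof.
  destruct (members_small w) as (A & f & hf).
  exists (A -> Prop), (fun p => collect (fun z => exists a, p a /\ f a = z)).
  intros y [hy h]. exists (fun a => mem (f a) y). apply collect_eq; [exact hy|].
  intro z. split; [|intros (a & h1 & <-); exact h1].
  intro hz. destruct (proj1 (hf z) (h z hz)) as [a <-]. eauto.
Qed.

(** [comprehension] with supports hidden: [P] need only be invariant under the permutations that fix
    finitely many parameters [l]. *)
Lemma collect_spec (l : list V) (P : V -> Prop) :
  is_small P ->
  (forall g, (forall x, In x l -> act g x = x) -> forall x, P x -> P (act g x)) ->
  ~ ur (collect P) /\ forall x, mem x (collect P) <-> P x.
Proof.
  intros hs hP. destruct (@comprehension P) as (s & h1 & h2).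
  - exact hs.
  - destruct (common_support l) as (K & E & h). exists K, E. auto.
  - rewrite (collect_eq h1 h2). auto.
Qed.

Notation sat := (holds mem (fun _ : unit => ur)).

(** Permutations are automorphisms, so they preserve every formula. *)
Lemma sat_act g a : forall r, sat r a <-> sat (fun i => act g (r i)) a.
Proof.
  induction a as [|x y|x y|p x|a IHa b IHb|a IH]; intro r; cbn.
  - reflexivity.
  - split; [intros ->; reflexivity|apply act_inj].
  - symmetry; apply act_mem.
  - symmetry; apply act_ur.
  - rewrite IHa, IHb. reflexivity.
  - assert (H : forall x, (fun i => act g (scons x r i)) = scons (act g x) (fun i => act g (r i))).
    { intro x. extensionality i; destruct i; reflexivity. }
    split; intros h x.
    + specialize (h (act (pinv g) x)). rewrite IH, H, actVK in h. exact h.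
    + rewrite IH, H. apply h.
Qed.

(** * Pairs *)

Definition up x y := collect (fun t => t = x \/ t = y).

Lemma up_spec x y : ~ ur (up x y) /\ forall t, mem t (up x y) <-> t = x \/ t = y.
Proof.
  apply (collect_spec (l := x :: y :: nil)).
  - exists bool, (fun b : bool => if b then x else y).
    intros t [->| ->]; [exists true|exists false]; auto.
  - intros g hg t [->| ->]; [left|right]; apply hg; cbn; auto.
Qed.

Lemma up_set x y : ~ ur (up x y).
Proof. apply up_spec. Qed.
Lemma mem_up x y t : mem t (up x y) <-> t = x \/ t = y.
Proof. apply up_spec. Qed.

Lemma mem_act g x y : mem x (act g y) <-> mem (act (pinv g) x) y.
Proof. rewrite <- (actVK g x) at 1. apply act_mem. Qed.

Lemma act_up g x y : act g (up x y) = up (act g x) (act g y).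
Proof.
  apply set_ext.
  - rewrite act_ur. apply up_set.
  - apply up_set.
  - intro z. rewrite mem_act, !mem_up.
    split; (intros [e|e]; [left|right]); [rewrite <- e; symmetry; apply actVK|
      rewrite <- e; symmetry; apply actVK|rewrite e; apply actK|rewrite e; apply actK].
Qed.

Lemma up_eq x y z : ~ ur z -> (forall t, mem t z <-> t = x \/ t = y) -> z = up x y.
Proof. intros hz h. apply set_ext; auto using up_set. intro t. rewrite h, mem_up. reflexivity. Qed.

Lemma mem_set x y : mem x y -> ~ ur y.
Proof. intros h k. apply (ur_empty k h). Qed.

Lemma up_inj x y z t : up x y = up z t -> x = z /\ y = t \/ x = t /\ y = z.
Proof.
  intro e.
  assert (h1 : x = z \/ x = t) by (rewrite <- mem_up, <- e, mem_up; auto).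
  assert (h2 : y = z \/ y = t) by (rewrite <- mem_up, <- e, mem_up; auto).
  assert (h3 : z = x \/ z = y) by (rewrite <- mem_up, e, mem_up; auto).
  assert (h4 : t = x \/ t = y) by (rewrite <- mem_up, e, mem_up; auto).
  intuition congruence.
Qed.

Definition pr x y := up (up x x) (up x y).

Lemma pr_inj x y z t : pr x y = pr z t -> x = z /\ y = t.
Proof.
  unfold pr. intro e. apply up_inj in e. destruct e as [[e1 e2]|[e1 e2]];
    apply up_inj in e1; apply up_inj in e2; intuition congruence.
Qed.

Lemma act_pr g x y : act g (pr x y) = pr (act g x) (act g y).
Proof. unfold pr. rewrite !act_up. reflexivity. Qed.

Lemma sat_upair r z x y : sat r (upair z x y) <-> r z = up (r x) (r y).
Proof.
  unfold upair. rewrite holds_all. setoid_rewrite holds_iff. setoid_rewrite holds_or. cbn.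
  split.
  - intro h. apply up_eq; [|exact h]. apply (@mem_set (r x)). apply h. auto.
  - intros -> t. apply mem_up.
Qed.

Lemma sat_opair r z x y : sat r (opair z x y) <-> r z = pr (r x) (r y).
Proof.
  unfold opair. rewrite holds_ex. setoid_rewrite holds_ex.
  setoid_rewrite holds_and. setoid_rewrite holds_and. setoid_rewrite sat_upair. cbn. split.
  - intros (a & b & -> & -> & ->). reflexivity.
  - intros ->. exists (up (r x) (r x)), (up (r x) (r y)). auto.
Qed.

Lemma sat_pair_in r f x y : sat r (pair_in f x y) <-> mem (pr (r x) (r y)) (r f).
Proof.
  unfold pair_in. rewrite holds_ExIn. setoid_rewrite sat_opair. cbn. split.
  - intros (z & h & ->). exact h.
  - intro h. eauto.
Qed.

(** * The axioms of ZFU *)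

Lemma sat_sub r x y : sat r (sub x y) <-> forall z, mem z (r x) -> mem z (r y).
Proof. reflexivity. Qed.

Lemma sat_empty r x : sat r (empty x) <-> forall z, ~ mem z (r x).
Proof. reflexivity. Qed.

Section Congruences.
Context (r : nat -> V) (x : nat) (a b : form unit) (A B : Prop) (C : V -> Prop).

Lemma imp_sem : (sat r a <-> A) -> (sat r b <-> B) -> sat r (Imp a b) <-> (A -> B).
Proof. rewrite holds_imp. tauto. Qed.
Lemma neg_sem : (sat r a <-> A) -> sat r (Neg a) <-> ~ A.
Proof. rewrite holds_neg. tauto. Qed.
Lemma or_sem : (sat r a <-> A) -> (sat r b <-> B) -> sat r (Or a b) <-> A \/ B.
Proof. rewrite holds_or. tauto. Qed.
Lemma and_sem : (sat r a <-> A) -> (sat r b <-> B) -> sat r (And a b) <-> A /\ B.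
Proof. rewrite holds_and. tauto. Qed.
Lemma iff_sem : (sat r a <-> A) -> (sat r b <-> B) -> sat r (Iff a b) <-> (A <-> B).
Proof. rewrite holds_iff. tauto. Qed.
Lemma all_sem : (forall y, sat (scons y r) a <-> C y) -> sat r (All a) <-> forall y, C y.
Proof. intro h. rewrite holds_all. setoid_rewrite h. reflexivity. Qed.
Lemma ex_sem : (forall y, sat (scons y r) a <-> C y) -> sat r (Ex a) <-> exists y, C y.
Proof. intro h. rewrite holds_ex. setoid_rewrite h. reflexivity. Qed.
Lemma AllIn_sem :
  (forall y, sat (scons y r) a <-> C y) -> sat r (AllIn x a) <-> forall y, mem y (r x) -> C y.
Proof. intro h. rewrite holds_AllIn. setoid_rewrite h. reflexivity. Qed.
Lemma ExIn_sem :
  (forall y, sat (scons y r) a <-> C y) -> sat r (ExIn x a) <-> exists y, mem y (r x) /\ C y.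
Proof. intro h. rewrite holds_ExIn. setoid_rewrite h. reflexivity. Qed.
Lemma ExUniq_sem :
  (forall y, sat (scons y r) a <-> C y) ->
  sat r (ExUniq a) <-> exists c, forall y, C y <-> y = c.
Proof. intro h. rewrite holds_ExUniq. setoid_rewrite h. reflexivity. Qed.

End Congruences.

Lemma ExSet_sem r a (C : V -> Prop) :
  (forall y, sat (scons y r) a <-> C y) -> sat r (zfu.ExSet a) <-> exists y, ~ ur y /\ C y.
Proof.
  intro h. apply (ex_sem (C := fun y => ~ ur y /\ C y)). intro y.
  apply and_sem; [apply iff_refl|apply h].
Qed.

(** [translate] computes, from a formula, its meaning in [V]. The tactic [leaf] is extended as
    further defined formulas receive a meaning. *)
Ltac leaf := fail.
Ltac by_lemma l := eapply iff_trans; [apply l|cbn [scons Nat.add]; apply iff_refl].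
Ltac translate := intros;
  lazymatch goal with
  | |- holds _ _ _ ?a <-> _ =>
    lazymatch a with
    | Imp _ _ => apply imp_sem; translate
    | Neg _ => apply neg_sem; translate
    | Or _ _ => apply or_sem; translate
    | And _ _ => apply and_sem; translate
    | Iff _ _ => apply iff_sem; translate
    | All _ => apply all_sem; translate
    | Ex _ => apply ex_sem; translate
    | AllIn _ _ => apply AllIn_sem; translate
    | ExIn _ _ => apply ExIn_sem; translate
    | ExUniq _ => apply ExUniq_sem; translate
    | zfu.ExSet _ => apply ExSet_sem; translate
    | sub _ _ => by_lemma sat_sub
    | empty _ => by_lemma sat_empty
    | opair _ _ _ => by_lemma sat_opair
    | upair _ _ _ => by_lemma sat_upair
    | pair_in _ _ _ => by_lemma sat_pair_in
    | zfu.isSet _ => unfold zfu.isSet, zfu.Ur; translate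
    | zfu.Ur _ => unfold zfu.Ur; translate
    | _ => first [leaf | cbn [holds scons Nat.add]; apply iff_refl]
    end
  end.

Lemma iff_backward (A B : Prop) : (A <-> B) -> B -> A.
Proof. tauto. Qed.

Ltac sem :=
  lazymatch goal with
  | |- _ <-> _ => eapply iff_trans; [translate|]
  | _ => eapply iff_backward; [translate|]
  end; cbn [scons Nat.add].

Lemma sat_extensionality r : sat r zfu.extensionality.
Proof.
  unfold zfu.extensionality. sem. intros x y [hx hy]. apply set_ext; assumption.
Qed.

Lemma sat_urelements_empty r : sat r zfu.urelements_empty.
Proof. unfold zfu.urelements_empty, zfu.Ur. sem. intros x hx z. apply ur_empty, hx. Qed.

Lemma sat_foundation r : sat r foundation.
Proof.
  unfold foundation. sem. intros x [y hy]. apply NNPP. intro h.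
  revert hy. pattern y. revert y. apply mem_ind. intros y IH hy.
  apply h. exists y. split; [exact hy|]. intros (z & hz & hzy). exact (IH z hzy hz).
Qed.

Lemma sat_pairing r : sat r pairing.
Proof. unfold pairing. sem. intros x y. exists (up x y). reflexivity. Qed.

Lemma sat_union r : sat r zfu.union.
Proof.
  unfold zfu.union. sem. intro x. eexists; apply (collect_spec (l := x :: nil)).
  - apply small_bigcup; [apply small_mem|]. intros y _. apply small_mem.
  - intros g hg y (z & hz & hy). exists (act g z).
    rewrite <- (hg x) by (left; reflexivity). rewrite !act_mem. auto.
Qed.

Lemma sat_powerset r : sat r zfu.powerset.
Proof.
  unfold zfu.powerset. sem. intro x. eexists; apply (collect_spec (l := x :: nil)).
  - apply small_powerset.
  - intros g hg y [hy h]. rewrite act_ur. split; [exact hy|]. intros z hz.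
    rewrite <- (hg x) by (left; reflexivity). rewrite mem_act in *. auto.
Qed.

Definition emp : V := collect (fun _ => False).
Definition suc (x : V) : V := collect (fun z => mem z x \/ z = x).

Lemma emp_spec : ~ ur emp /\ forall z, mem z emp <-> False.
Proof.
  apply (collect_spec (l := nil)); [|tauto].
  exists Empty_set, (fun e : Empty_set => match e with end). tauto.
Qed.

Lemma suc_spec x : ~ ur (suc x) /\ forall z, mem z (suc x) <-> mem z x \/ z = x.
Proof.
  apply (collect_spec (l := x :: nil)).
  - destruct (small_mem x) as (A & f & h).
    exists (option A), (fun o => match o with Some a => f a | None => x end).
    intros z [hz| ->]; [|exists None; reflexivity].
    destruct (h z hz) as [a ha]. exists (Some a). exact ha.
  - intros g hg z hz. rewrite <- (hg x) by (left; reflexivity). rewrite act_mem.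
    destruct hz as [hz| ->]; auto.
Qed.

Lemma emp_set : ~ ur emp.
Proof. apply emp_spec. Qed.
Lemma mem_emp z : ~ mem z emp.
Proof. intro h. apply emp_spec in h. exact h. Qed.
Lemma suc_set x : ~ ur (suc x).
Proof. apply suc_spec. Qed.
Lemma mem_suc x z : mem z (suc x) <-> mem z x \/ z = x.
Proof. apply suc_spec. Qed.

Lemma act_emp g : act g emp = emp.
Proof.
  apply set_ext; rewrite ?act_ur; auto using emp_set.
  intro z. rewrite mem_act. split; intro h; exfalso; revert h; apply mem_emp.
Qed.

Lemma act_suc g x : act g (suc x) = suc (act g x).
Proof.
  apply set_ext; rewrite ?act_ur; auto using suc_set.
  intro z. rewrite mem_act, !mem_suc, mem_act.
  split; (intros [e|e]; [left; exact e|right]).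
  - rewrite <- e. symmetry; apply actVK.
  - rewrite e. apply actK.
Qed.

Fixpoint num (n : nat) : V := match n with 0 => emp | S n => suc (num n) end.

Lemma act_num g n : act g (num n) = num n.
Proof. induction n; cbn; [apply act_emp|rewrite act_suc, IHn; reflexivity]. Qed.

Lemma sat_infinity r : sat r zfu.infinity.
Proof.
  unfold zfu.infinity, succ. sem.
  destruct (@collect_spec nil (fun x => exists n, x = num n)) as [hw h].
  - apply small_range.
  - intros g _ x [n ->]. exists n. apply act_num.
  - eexists. split; [exact hw|]. split.
    + exists emp. split; [apply h; exists 0; reflexivity|]. split; [apply emp_set|apply mem_emp].
    + intros x hx. apply h in hx. destruct hx as [n ->]. exists (num (S n)).
      split; [apply h; eauto|]. apply mem_suc.
Qed.

(** A permutation fixing the parameters of a formula may be applied to its other arguments [xs]. *)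
Lemma sat_act_fixed n a (g : perm) r (xs : list V) :
  bounded (length xs + n) a ->
  (forall i, i < n -> act g (r i) = r i) ->
  sat (fold_right scons r xs) a <-> sat (fold_right scons r (map (act g) xs)) a.
Proof.
  intros hb hg. rewrite (sat_act g). apply holds_bounded with (1 := hb).
  clear hb. induction xs as [|x xs IH]; cbn.
  - exact hg.
  - intros [|i] hi; [reflexivity|]. apply IH. lia.
Qed.

Lemma sat_separation n a r : bounded (1 + n) a -> sat r (zfu.separation n a).
Proof.
  intro hb. unfold zfu.separation. apply holds_alls. clear r. intro r. sem. intro w.
  assert (H : forall x y, sat (scons x (scons y (scons w r))) (weaken 1 2 a) <-> sat (scons x r) a).
  { intros x y. unfold weaken. rewrite holds_ren. apply holds_ext. intros [|i]; reflexivity. }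
  setoid_rewrite H.
  eexists. apply (collect_spec (l := w :: map r (List.seq 0 n))).
  - apply small_sub with (2 := small_mem w). tauto.
  - intros g hg x [hx ha]. split.
    + rewrite <- (hg w) by (left; reflexivity). apply act_mem, hx.
    + apply (@sat_act_fixed n a g r (x :: nil)); [exact hb| |exact ha].
      intros i hi. apply hg. right. apply in_map, in_seq. lia.
Qed.

Lemma sat_replacement n a r : bounded (2 + n) a -> sat r (replacement n a).
Proof.
  intro hb. unfold replacement. apply holds_alls. clear r. intro r. sem. intro w.
  assert (H : forall x y,
            sat (scons y (scons x (scons w r))) (weaken 2 1 a) <-> sat (scons y (scons x r)) a).
  { intros x y. unfold weaken. rewrite holds_ren. apply holds_ext. intros [|[|i]]; reflexivity. }
  setoid_rewrite H.
  assert (H' : forall x y z,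
            sat (scons y (scons x (scons z (scons w r)))) (weaken 2 2 a)
            <-> sat (scons y (scons x r)) a).
  { intros x y z. unfold weaken. rewrite holds_ren. apply holds_ext. intros [|[|i]]; reflexivity. }
  setoid_rewrite H'. intro hf.
  destruct (@collect_spec (w :: map r (List.seq 0 n))
              (fun y => exists x, mem x w /\ sat (scons y (scons x r)) a)) as [_ hv].
  - apply small_bigcup; [apply small_mem|]. intros x hx. destruct (hf x hx) as [c hc].
    apply small_sub with (2 := small_eq c). apply hc.
  - intros g hg y (x & hx & hy). exists (act g x). split.
    + rewrite <- (hg w) by (left; reflexivity). apply act_mem, hx.
    + apply (@sat_act_fixed n a g r (y :: x :: nil)); [exact hb| |exact hy].
      intros i hi. apply hg. right. apply in_map, in_seq. lia.
  - eexists. intros x hx. destruct (hf x hx) as [c hc].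
    assert (hy := proj2 (hc c) eq_refl). exists c. split; [apply hv; eauto|exact hy].
Qed.

Lemma sat_ZFU a : ZFU a -> forall r, sat r a.
Proof.
  intros [] r.
  - apply sat_extensionality.
  - apply sat_urelements_empty.
  - apply sat_foundation.
  - apply sat_pairing.
  - apply sat_union.
  - apply sat_powerset.
  - apply sat_infinity.
  - apply sat_separation; assumption.
  - apply sat_replacement; assumption.
Qed.

(** * Functions and ordinals of the model *)

Definition is_func (f x y : V) : Prop :=
  ~ ur f
  /\ (forall t, mem t f -> exists a, mem a x /\ exists b, mem b y /\ t = pr a b)
  /\ (forall a, mem a x -> exists c, forall b, mem (pr a b) f <-> b = c).

Lemma sat_func r f x y : sat r (zfu.func f x y) <-> is_func (r f) (r x) (r y).
Proof. unfold zfu.func, is_func. sem. reflexivity. Qed.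

Ltac leaf ::= by_lemma sat_func.

Definition is_surj (f x y : V) : Prop :=
  is_func f x y /\ forall b, mem b y -> exists a, mem a x /\ mem (pr a b) f.

Lemma sat_surjection r f x y : sat r (zfu.surjection f x y) <-> is_surj (r f) (r x) (r y).
Proof. unfold zfu.surjection, is_surj. sem. reflexivity. Qed.

Definition is_inj (f x y : V) : Prop :=
  is_func f x y /\ forall a, mem a x -> forall b, mem b x -> forall c, mem c y ->
    mem (pr a c) f -> mem (pr b c) f -> a = b.

Lemma sat_injection r f x y : sat r (zfu.injection f x y) <-> is_inj (r f) (r x) (r y).
Proof. unfold zfu.injection, is_inj. sem. reflexivity. Qed.

Ltac leaf ::= first [by_lemma sat_func | by_lemma sat_injection | by_lemma sat_surjection].

Lemma mem_act_ex g x z : mem z (act g x) <-> exists y, mem y x /\ z = act g y.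
Proof.
  rewrite mem_act. split.
  - intro h. eexists. split; [exact h|]. symmetry. apply actVK.
  - intros (y & hy & ->). rewrite actK. exact hy.
Qed.

Lemma mem_irrefl x : ~ mem x x.
Proof. revert x. apply mem_ind. intros x IH h. exact (IH x h h). Qed.

Definition is_ord (a : V) : Prop :=
  ~ ur a
  /\ (forall y, mem y a -> forall z, mem z y -> mem z a)
  /\ (forall u, ur u -> ~ forall t,
        ~ ur t /\ (forall y, mem y t -> forall z, mem z y -> mem z t)
        /\ (forall z, mem z a -> mem z t) -> mem u t)
  /\ ((forall x, mem x a -> ~ mem x x)
      /\ (forall x, mem x a -> forall y, mem y a -> forall z, mem z a ->
            mem x y -> mem y z -> mem x z)
      /\ (forall x, mem x a -> forall y, mem y a -> mem x y \/ x = y \/ mem y x)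
      /\ (forall b, (forall z, mem z b -> mem z a) /\ (exists x, mem x b) ->
            exists m, mem m b /\ forall y, mem y b -> m = y \/ mem m y)).

Lemma sat_ordinal r x : sat r (zfu.ordinal x) <-> is_ord (r x).
Proof.
  unfold zfu.ordinal, is_ord, is_transitive, zfu.in_trcl, zfu.well_ordered, is_transitive.
  sem. reflexivity.
Qed.

Ltac leaf ::= first [by_lemma sat_func | by_lemma sat_injection | by_lemma sat_surjection
  | by_lemma sat_ordinal].

(** * Plenitude *)

(** No urelement occurs in the transitive closure of an ordinal, so there is nothing to move. *)
Lemma ordinal_fixed a : is_ord a -> forall x, mem x a -> forall g, act g x = x.
Proof.
  intros (_ & ht & hu & _). apply (mem_ind (P := fun x => mem x a -> forall g, act g x = x)).
  intros x IH hx g.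
  assert (hs : ~ ur x).
  { intro h. apply (hu x h). intros t (_ & _ & hat). exact (hat x hx). }
  apply set_ext; [rewrite act_ur; exact hs|exact hs|].
  intro z. rewrite mem_act_ex. split.
  - intros (y & hy & ->). rewrite IH; eauto.
  - intro hz. exists z. split; [exact hz|]. symmetry. eauto.
Qed.

Lemma small_embeds_Idx (w : V) :
  exists c : V -> Idx, forall x y, mem x w -> mem y w -> c x = c y -> x = y.
Proof.
  destruct (members_small w) as (A & f & hf). destruct (Idx_embeds_small A) as [e he].
  set (c := fun x => epsilon (inhabits base) (fun i => exists a, f a = x /\ e a = i)).
  assert (hc : forall x, mem x w -> exists a, f a = x /\ e a = c x).
  { intros x hx. apply hf in hx. destruct hx as [a ha].
    apply (epsilon_spec (inhabits base) (fun i => exists a, f a = x /\ e a = i)). eauto. }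
  exists c. intros x y hx hy E.
  destruct (hc x hx) as (a & <- & ea). destruct (hc y hy) as (b & <- & eb).
  f_equal. apply he. congruence.
Qed.

Lemma small_map (P : V -> Prop) (f : V -> V) :
  is_small P -> is_small (fun y => exists x, P x /\ y = f x).
Proof. intro h. apply small_bigcup; [exact h|]. intros x _. apply small_eq. Qed.

Lemma sat_plenitude r : sat r zfu.plenitude.
Proof.
  unfold zfu.plenitude, zfu.equinumerous. sem. intros a ha.
  assert (fix_a := ordinal_fixed ha).
  destruct (small_embeds_Idx a) as [c hc].
  set (u := fun x => of_atom (Pln (c x))).
  assert (hu : forall g x, act g (u x) = u x) by (intros; apply act_of_atom).
  assert (u_inj : forall x y, mem x a -> mem y a -> u x = u y -> x = y).
  { intros x y hx hy e. apply of_atom_inj in e. apply hc; congruence. }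
  destruct (@collect_spec nil (fun t => exists x, mem x a /\ t = u x)) as [s_set hs].
  { apply small_map, small_mem. }
  { intros g _ t (x & hx & ->). exists x. rewrite hu. auto. }
  destruct (@collect_spec nil (fun t => exists x, mem x a /\ t = pr (u x) x)) as [f_set hf].
  { apply small_map, small_mem. }
  { intros g _ t (x & hx & ->). exists x. rewrite act_pr, hu, fix_a; auto. }
  set (s := collect _) in hs. set (f := collect _) in hf.
  assert (hp : forall x y, mem x a -> mem (pr (u x) y) f <-> y = x).
  { intros x y hx. rewrite hf. split.
    - intros (z & hz & e). apply pr_inj in e. destruct e as [e1 ->]. symmetry. auto.
    - intros ->. eauto. }
  assert (hfun : is_func f s a).
  { split; [exact f_set|]. split.
    - intros t ht. apply hf in ht. destruct ht as (x & hx & ->).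
      exists (u x). split; [apply hs; eauto|]. eauto.
    - intros t ht. apply hs in ht. destruct ht as (x & hx & ->). exists x. intro y.
      apply hp, hx. }
  exists s. split; [exact s_set|]. split.
  - intros t ht. apply hs in ht. destruct ht as (x & _ & ->). apply of_atom_ur.
  - exists f. split; (split; [exact hfun|]).
    + intros t ht t' ht' y hy h h'. apply hs in ht. apply hs in ht'.
      destruct ht as (x & hx & ->). destruct ht' as (x' & hx' & ->).
      apply hp in h; [|assumption]. apply hp in h'; [|assumption]. congruence.
    + intros y hy. exists (u y). split; [apply hs; eauto|]. apply hp; auto.
Qed.

(** * Ordinals from well-orders *)

(** The strict part of the order given by the well-ordering principle, whose order is boolean and
    well-ordered in the sense that every inhabited subset has exactly one least element. *)
Lemma well_order_exists (A : small) :
  exists R : A -> A -> Prop, well_founded R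
    /\ (forall x y, R x y \/ x = y \/ R y x) /\ (forall x y z, R x y -> R y z -> R x z).
Proof.
  destruct (wochoice.well_ordering_principle
              (boolp.boolp_classicType__canonical__eqtype_Equality A)) as [r hr].
  set (le := fun x y : A => is_true (r x y)).
  assert (hmin : forall P : A -> Prop, (exists x, P x) ->
            exists z, P z /\ (forall y, P y -> le z y)
                      /\ forall z', P z' -> (forall y, P y -> le z' y) -> z = z').
  { intros P [x hx]. destruct (hr (fun x => boolp.asbool (P x))) as (z & [h1 h2] & h3).
    - exists x. apply boolp.asboolT, hx.
    - exists z. split; [apply boolp.asboolW, h1|]. split.
      + intros y hy. apply h2. apply boolp.asboolT, hy.
      + intros z' h h'. apply h3. split; [apply boolp.asboolT, h|].
        intros y hy. apply h', boolp.asboolW, hy. }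
  assert (le_refl : forall x, le x x).
  { intro x. destruct (hmin (eq x) (ex_intro _ x eq_refl)) as (z & -> & h & _). auto. }
  assert (antisym : forall x y, le x y -> le y x -> x = y).
  { intros x y h h'.
    destruct (hmin (fun t => t = x \/ t = y) (ex_intro _ x (or_introl eq_refl))) as (z & _ & _ & u).
    transitivity z; [symmetry|]; apply u; auto; intros t [->| ->]; auto. }
  assert (total : forall x y, le x y \/ le y x).
  { intros x y.
    destruct (hmin (fun t => t = x \/ t = y) (ex_intro _ x (or_introl eq_refl)))
      as (z & [->| ->] & h & _); auto. }
  assert (trans : forall x y z, le x y -> le y z -> le x z).
  { intros x y z h h'.
    destruct (hmin (fun t => t = x \/ t = y \/ t = z) (ex_intro _ x (or_introl eq_refl)))
      as (m & hm & k & _).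
    destruct hm as [->|[->| ->]]; auto.
    - rewrite (antisym x y); auto.
    - assert (e : y = z) by auto. subst z. exact h. }
  exists (fun x y => le x y /\ x <> y). split; [|split].
  - intro x. apply NNPP. intro h.
    destruct (hmin (fun x => ~ Acc (fun x y => le x y /\ x <> y) x)) as (m & hm & k & _); [eauto|].
    apply hm. constructor. intros y [h1 h2]. apply NNPP. intro hy.
    apply h2, antisym; auto.
  - intros x y. destruct (classic (x = y)); [auto|]. destruct (total x y); auto.
  - intros x y z [h1 n1] [h2 n2]. split; [eauto|]. intros <-. auto.
Qed.

Section Rank.
Context (A : small) (R : A -> A -> Prop) (wf : well_founded R)
  (trichotomy : forall x y, R x y \/ x = y \/ R y x)
  (trans : forall x y z, R x y -> R y z -> R x z).

(** The Mostowski collapse of the well-order [R]; it is a pure set, hence in the model. *)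
Definition rank : A -> V :=
  Fix wf (fun _ => V) (fun a rec => collect (fun z => exists b (h : R b a), z = rec b h)).

Lemma rank_eq a : rank a = collect (fun z => exists b, R b a /\ z = rank b).
Proof.
  unfold rank at 1. rewrite Fix_eq.
  - f_equal. extensionality z. apply propositional_extensionality.
    split; [intros (b & h & e)|intros (b & h & e)]; eauto.
  - intros x f g h. f_equal. extensionality z. apply propositional_extensionality.
    split; intros (b & k & ->); exists b, k; auto.
Qed.

Lemma act_rank a : forall g, act g (rank a) = rank a.
Proof.
  induction (wf a) as [a _ IH]. intro g.
  destruct (@collect_spec nil (fun z => exists b, R b a /\ z = rank b)) as [h1 h2].
  { apply small_sub with (2 := small_range rank). intros x (b & _ & e). eauto. }
  { intros k _ x (b & hb & ->). exists b. rewrite IH; auto. }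
  rewrite <- rank_eq in h1, h2. apply set_ext; [rewrite act_ur; exact h1|exact h1|].
  intro z. rewrite mem_act_ex. split.
  - intros (y & hy & ->). assert (hy' := hy). apply h2 in hy'. destruct hy' as (b & hb & ->).
    rewrite IH; assumption.
  - intro hz. exists z. split; [exact hz|]. apply h2 in hz. destruct hz as (b & hb & ->).
    symmetry. auto.
Qed.

Lemma rank_spec a : ~ ur (rank a) /\ forall z, mem z (rank a) <-> exists b, R b a /\ z = rank b.
Proof.
  rewrite rank_eq. apply (collect_spec (l := nil)).
  - apply small_sub with (2 := small_range rank). intros x (b & _ & e). eauto.
  - intros k _ x (b & hb & ->). exists b. rewrite act_rank. auto.
Qed.

Lemma rank_inj a b : rank a = rank b -> a = b.
Proof.
  intro e. destruct (trichotomy a b) as [h|[h|h]]; [exfalso| assumption |exfalso].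
  - apply (@mem_irrefl (rank b)). rewrite <- e at 1. apply rank_spec. eauto.
  - apply (@mem_irrefl (rank a)). rewrite e at 1. apply rank_spec. eauto.
Qed.

Lemma mem_rank a b : mem (rank a) (rank b) <-> R a b.
Proof.
  split.
  - intro h. apply rank_spec in h. destruct h as (c & hc & e). apply rank_inj in e. congruence.
  - intro h. apply rank_spec. eauto.
Qed.

Definition order_type : V := collect (fun z => exists a, z = rank a).

Lemma order_type_spec : ~ ur order_type /\ forall z, mem z order_type <-> exists a, z = rank a.
Proof.
  apply (collect_spec (l := nil)).
  - apply small_range.
  - intros k _ x (b & ->). exists b. apply act_rank.
Qed.

Lemma order_type_ord : is_ord order_type.
Proof.
  destruct order_type_spec as [hs hm].
  assert (ht : forall y, mem y order_type -> forall z, mem z y -> mem z order_type).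
  { intros y hy z hz. apply hm in hy. destruct hy as [a ->]. apply rank_spec in hz.
    destruct hz as (b & _ & ->). apply hm. eauto. }
  split; [exact hs|]. split; [exact ht|]. split; [|split; [|split; [|split]]].
  - intros u hu h. assert (k : mem u order_type) by (apply h; auto).
    apply hm in k. destruct k as [a ->]. revert hu. apply rank_spec.
  - intros x _. apply mem_irrefl.
  - intros x hx y hy z hz. apply hm in hx. apply hm in hy. apply hm in hz.
    destruct hx as [a ->], hy as [b ->], hz as [c ->]. rewrite !mem_rank. apply trans.
  - intros x hx y hy. apply hm in hx. apply hm in hy.
    destruct hx as [a ->], hy as [b ->]. rewrite !mem_rank.
    destruct (trichotomy a b) as [h|[->|h]]; auto.
  - intros b [hb [x hx]].
    assert (H : exists a, mem (rank a) b /\ forall c, R c a -> ~ mem (rank c) b).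
    { apply NNPP. intro n. assert (hx' := hb x hx). apply hm in hx'. destruct hx' as [a ->].
      revert hx. induction (wf a) as [a _ IH]. intro h. apply n. exists a. split; [exact h|].
      exact IH. }
    destruct H as (a & ha & hmin). exists (rank a). split; [exact ha|].
    intros y hy. assert (hy' := hb y hy). apply hm in hy'. destruct hy' as [c ->].
    rewrite mem_rank. destruct (trichotomy a c) as [h|[->|h]]; auto.
    exfalso. exact (hmin c h hy).
Qed.

End Rank.

(** * Blocks occurring in a set *)

(** The kernel of [x], i.e. the atoms in the transitive closure of its singleton, meets the
    block [i]. *)
Inductive occ (i : Idx) : V -> Prop :=
| occ_at d : occ i (of_atom (Blk i d))
| occ_mem y x : mem y x -> occ i y -> occ i x.

Lemma occ_act (g : perm) i x : occ i x -> occ (fst g i) (act g x).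
Proof.
  induction 1 as [d|y x h _ IH].
  - rewrite act_of_atom. apply occ_at.
  - apply occ_mem with (2 := IH). apply act_mem, h.
Qed.

Lemma occ_small x : exists (A : small) (f : A -> Idx), forall i, occ i x -> exists a, f a = i.
Proof.
  revert x. apply mem_ind. intros x IH.
  destruct (members_small x) as (A & f & hf).
  assert (H : forall a, exists F : {B : small & B -> Idx},
             forall i, occ i (f a) -> exists b, projT2 F b = i).
  { intro a. destruct (IH (f a)) as (B & k & hk); [apply hf; eauto|].
    exists (existT _ B k). exact hk. }
  set (F := fun a => proj1_sig (constructive_indefinite_description _ (H a))).
  set (own := epsilon (inhabits base) (fun i => exists d, x = of_atom (Blk i d))).
  exists (option {a : A & projT1 (F a)}),
    (fun o => match o with Some c => projT2 (F (projT1 c)) (projT2 c) | None => own end).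
  intros i hi. inversion hi as [d e|y z hy hi' e]; subst.
  - exists None.
    destruct (epsilon_spec (inhabits base)
                (fun j => exists e, of_atom (Blk i d) = of_atom (Blk j e))) as [e he]; [eauto|].
    apply of_atom_inj in he. unfold own. congruence.
  - apply hf in hy. destruct hy as [a <-].
    destruct (proj2_sig (constructive_indefinite_description _ (H a)) i hi') as [b hb].
    exists (Some (existT _ a b)). exact hb.
Qed.

(** If [i] were outside [K], it could be swapped with an index [j] that neither occurs in [x] nor
    belongs to [K]: the swap fixes [x], so [j] would occur as well. *)
Lemma occ_support K E x i : supports K E x -> occ i x -> In i K.
Proof.
  intros hs hi. apply NNPP. intro hK.
  destruct (occ_small x) as (A & f & hf).
  destruct (@Idx_not_small (A + nat)%type
              (fun c => match c with inl a => f a | inr n => nth n K base end)) as [j hj].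
  assert (jx : ~ occ j x).
  { intro h. destruct (hf j h) as [a ha]. exact (hj (inl a) ha). }
  assert (jK : ~ In j K).
  { intro h. destruct (In_nth K j base h) as (n & _ & e). exact (hj (inr n) e). }
  set (g := (swap i j, idb nat) : perm).
  assert (hg : fixes K E g).
  { split; [|reflexivity]. intros k hk. apply swap_other; congruence. }
  apply jx. rewrite <- (hs g hg), <- (swap_l i j). apply (occ_act g hi).
Qed.

(** Only the blocks that occur in [x] matter for the action on [x]. *)
Lemma act_agree (g h : perm) x :
  (forall i, occ i x -> fst g i = fst h i) -> (forall d, snd g d = snd h d) -> act g x = act h x.
Proof.
  intros h1 h2. revert x h1. apply (mem_ind (P := fun x =>
    (forall i, occ i x -> fst g i = fst h i) -> act g x = act h x)).
  intros x IH h1. destruct (classic (ur x)) as [hu|hu].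
  - apply ur_of_atom in hu. destruct hu as [[i d|j] ->]; rewrite !act_of_atom; cbn.
    + rewrite h1, h2; [reflexivity|apply occ_at].
    + reflexivity.
  - assert (e : forall y, mem y x -> act g y = act h y).
    { intros y hy. apply IH; [exact hy|]. intros i hi. apply h1, occ_mem with (1 := hy), hi. }
    apply set_ext; rewrite ?act_ur; auto. intro z. rewrite !mem_act_ex.
    split; intros (y & hy & ->); exists y; split; auto. symmetry. auto.
Qed.

(** The index part [K] of a support passes from a set to its members: on a member, permutations
    of indices fixing [K] act trivially, because all its blocks are in [K]. *)
Lemma member_support K E x y : supports K E x -> mem y x -> exists F, supports K F y.
Proof.
  intros hx hy. destruct (finite_support y) as (L & F & h). exists F. intros g [g1 g2].
  transitivity (act (idb Idx, snd g) y).
  - apply act_agree; [|reflexivity]. intros i hi. apply g1.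
    apply (occ_support hx), occ_mem with (1 := hy), hi.
  - apply h. split; [reflexivity|exact g2].
Qed.

(** * SVC *)

(** A tuple of atoms of the block [base], as iterated pairs. *)
Fixpoint code (e : list nat) : V :=
  match e with nil => emp | d :: e => pr (of_atom (Blk base d)) (code e) end.

Lemma pr_neq_emp x y : pr x y <> emp.
Proof.
  intro e. apply (@mem_emp (up x x)). rewrite <- e. apply mem_up. auto.
Qed.

Lemma code_inj d : forall e, code d = code e -> d = e.
Proof.
  induction d as [|m d IH]; intros [|n e] h; cbn in h.
  - reflexivity.
  - symmetry in h. destruct (pr_neq_emp h).
  - destruct (pr_neq_emp h).
  - apply pr_inj in h. destruct h as [h1 h2]. apply of_atom_inj in h1. f_equal; [congruence|auto].
Qed.

Lemma act_code (g : perm) e : fst g base = base -> act g (code e) = code (map (snd g) e).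
Proof.
  intro h. induction e as [|d e IH]; cbn; [apply act_emp|].
  rewrite act_pr, IH, act_of_atom. cbn. rewrite h. reflexivity.
Qed.

(** The set [S] of SVC. *)
Definition tuples : V := collect (fun z => exists e, z = code e).

Lemma tuples_spec : ~ ur tuples /\ forall z, mem z tuples <-> exists e, z = code e.
Proof.
  apply (collect_spec (l := of_atom (Blk base 0) :: nil)); [apply small_range|].
  intros g hg z [e ->]. exists (map (snd g) e). apply act_code.
  assert (h : act g (of_atom (Blk base 0)) = of_atom (Blk base 0)) by (apply hg; left; reflexivity).
  rewrite act_of_atom in h. apply of_atom_inj in h. cbn in h. congruence.
Qed.

(** The translate of [y] is determined by that of a supporting tuple: [h^-1 g] fixes the tuple. *)
Lemma act_determined K E (g h : perm) y e :
  supports K e y -> fixes K E g -> fixes K E h -> map (snd g) e = map (snd h) e ->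
  act g y = act h y.
Proof.
  intros hy hg hh heq. apply (act_inj (g := pinv h)). rewrite actK, <- act_comp. apply hy.
  split.
  - intros i hi. cbn. rewrite (proj1 hg i hi), <- (proj1 hh i hi) at 1. apply fwdK.
  - intros d hd. cbn.
    assert (k : snd g d = snd h d) by exact (proj1 map_ext_in_iff heq d hd).
    rewrite k. apply fwdK.
Qed.

Lemma fixes_comp K E g h : fixes K E g -> fixes K E h -> fixes K E (pcomp g h).
Proof.
  intros [g1 g2] [h1 h2]. split; intros i hi; cbn; [rewrite h1, g1|rewrite h2, g2]; auto.
Qed.

Lemma small_product x y : is_small (fun z => exists a, mem a x /\ exists b, mem b y /\ z = pr a b).
Proof. apply small_bigcup; [apply small_mem|]. intros a _. apply small_map, small_mem. Qed.

Lemma product_spec x y :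
  exists p, ~ ur p /\ forall z, mem z p <-> exists a, mem a x /\ exists b, mem b y /\ z = pr a b.
Proof.
  eexists. apply (collect_spec (l := x :: y :: nil)); [apply small_product|].
  intros g hg z (a & ha & b & hb & ->).
  exists (act g a). split; [rewrite <- (hg x) by (cbn; auto); apply act_mem, ha|].
  exists (act g b). split; [rewrite <- (hg y) by (cbn; auto); apply act_mem, hb|].
  apply act_pr.
Qed.

(** The surjection sends the pair of a tuple [e] and the position of the member [m a] to the
    translate [act g (m a)], for any [g] that fixes a support of [x] and carries the chosen
    supporting tuple [s a] of [m a] to [e]; if there is no such [g], it takes the value [x0]. *)
Lemma surjection_from_tuples x x0 : ~ ur x -> mem x0 x ->
  exists a p f, is_ord a
    /\ (~ ur p /\ forall z, mem z p <-> exists s, mem s tuples /\ exists b, mem b a /\ z = pr s b)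
    /\ is_surj f p x.
Proof.
  intros hx hx0. destruct (members_small x) as (A & m & hm).
  destruct (well_order_exists A) as (R & wf & tri & trans).
  destruct (product_spec tuples (order_type wf)) as (p & hp & p_spec).
  assert (o_spec := proj2 (order_type_spec wf)).
  (* An atom of the block [base] is included so that the permutations fixing [K] and [E] act on
     codes by their action on tuples. *)
  destruct (common_support (x :: x0 :: of_atom (Blk base 0) :: nil)) as (K & E & hKE).
  assert (KE_x : supports K E x) by (intros g hg; apply (hKE g hg); cbn; auto).
  assert (KE_x0 : forall g, fixes K E g -> act g x0 = x0).
  { intros g hg; apply (hKE g hg); cbn; auto. }
  assert (KE_base : forall g, fixes K E g -> fst g base = base).
  { intros g hg. assert (h : act g (of_atom (Blk base 0)) = of_atom (Blk base 0)).
    { apply (hKE g hg); cbn; auto. }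
    rewrite act_of_atom in h. apply of_atom_inj in h. cbn in h. congruence. }
  clear hKE.
  assert (H : forall a, exists e, supports K e (m a)).
  { intro a. apply (member_support KE_x), hm. eauto. }
  set (s := fun a => proj1_sig (constructive_indefinite_description _ (H a))).
  assert (hs : forall a, supports K (s a) (m a)).
  { intro a. exact (proj2_sig (constructive_indefinite_description _ (H a))). }
  (* [value] is invariant because [moves] is: compose with the given permutation. *)
  set (moves := fun a e g => fixes K E g /\ e = map (snd g) (s a)).
  set (value := fun a e y => (exists g, moves a e g /\ y = act g (m a))
                             \/ (~ (exists g, moves a e g) /\ y = x0)).
  assert (value_ex : forall a e, exists y, forall z, value a e z <-> z = y).
  { intros a e. destruct (classic (exists g, moves a e g)) as [[g [hg he]]|n].
    - exists (act g (m a)). intro z. split.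
      + intros [(h & [hh he'] & ->)|[n _]]; [|destruct n; exists g; split; assumption].
        apply (act_determined (hs a) hh hg). congruence.
      + intros ->. left. exists g. repeat split; auto; apply hg.
    - exists x0. intro z. split.
      + intros [(h & hh & _)|[_ ->]]; [destruct n; eauto|reflexivity].
      + intros ->. right. auto. }
  assert (value_x : forall a e y, value a e y -> mem y x).
  { intros a e y [(g & [hg _] & ->)|[_ ->]]; [|exact hx0].
    rewrite <- (KE_x g hg). apply act_mem, hm. eauto. }
  assert (moves_act : forall g a e h, fixes K E g -> moves a e h ->
            moves a (map (snd g) e) (pcomp g h)).
  { intros g a e h hg [hh ->].
    split; [apply fixes_comp; assumption|]. rewrite map_map. reflexivity. }
  assert (value_act : forall g a e y, fixes K E g -> value a e y ->
            value a (map (snd g) e) (act g y)).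
  { intros g a e y hg [(h & hh & ->)|[n ->]].
    - left. exists (pcomp g h). split; [auto|]. rewrite act_comp. reflexivity.
    - right. split; [|apply KE_x0, hg]. intros [h hh]. apply n.
      apply (moves_act (pinv g)) in hh; [|apply fixes_inv, hg].
      exists (pcomp (pinv g) h). rewrite map_map in hh.
      rewrite (map_ext (fun d => snd (pinv g) (snd g d)) (fun d => d)), map_id in hh; [exact hh|].
      intro d. apply fwdK. }
  destruct (@comprehension
              (fun t => exists a e y, value a e y /\ t = pr (pr (code e) (rank wf a)) y))
    as (f & f_set & hf).
  { destruct (small_bigcup (P := fun q => exists c, q = pr (code (snd c)) (rank wf (fst c)))
                (Q := fun q t => exists y, mem y x /\ t = pr q y)) as (B & k & hk).
    - apply (small_range (fun c : A * list nat => pr (code (snd c)) (rank wf (fst c)))).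
    - intros q _. apply small_map, small_mem.
    - exists B, k. intros t (a & e & y & hy & ->). apply hk.
      exists (pr (code e) (rank wf a)). split; [exists (a, e); reflexivity|].
      exists y. split; [exact (value_x _ _ _ hy)|reflexivity]. }
  { exists K, E. intros g hg t (a & e & y & hy & ->).
    exists a, (map (snd g) e), (act g y). split; [auto|].
    rewrite !act_pr, act_rank, act_code by auto. reflexivity. }
  assert (f_pair : forall a e y, mem (pr (pr (code e) (rank wf a)) y) f <-> value a e y).
  { intros a e y. rewrite hf. split; [|eauto 6].
    intros (a' & e' & y' & h & eq). apply pr_inj in eq. destruct eq as [eq ->].
    apply pr_inj in eq. destruct eq as [e1 e2]. apply code_inj in e1.
    apply (rank_inj tri) in e2. congruence. }
  assert (in_p : forall a e, mem (pr (code e) (rank wf a)) p).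
  { intros a e. apply p_spec. exists (code e). split; [apply tuples_spec; eauto|].
    exists (rank wf a). split; [apply o_spec; eauto|reflexivity]. }
  exists (order_type wf), p, f. split; [apply order_type_ord; assumption|]. split; [auto|].
  split; [split; [exact f_set|split]|].
  - intros t ht. apply hf in ht. destruct ht as (a & e & y & hy & ->).
    exists (pr (code e) (rank wf a)). split; [apply in_p|]. exists y. split; [|reflexivity].
    exact (value_x _ _ _ hy).
  - intros q hq. apply p_spec in hq. destruct hq as (c & hc & b & hb & ->).
    apply tuples_spec in hc. destruct hc as [e ->]. apply o_spec in hb. destruct hb as [a ->].
    destruct (value_ex a e) as [y hy]. exists y. intro z. rewrite f_pair. apply hy.
  - intros y hy. apply hm in hy. destruct hy as [a <-].
    exists (pr (code (s a)) (rank wf a)). split; [apply in_p|]. apply f_pair. left.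
    (* the chosen tuple of [m a] itself, carried by the identity *)
    set (id_ := (idb Idx, idb nat) : perm). exists id_. split.
    + split; [split; reflexivity|]. symmetry. apply map_id.
    + symmetry. apply act_id; reflexivity.
Qed.

Lemma sat_svc r : sat r zfu.svc.
Proof.
  unfold zfu.svc, zfu.svc_of, zfu.product, zfu.surj_le. sem.
  exists tuples. split; [apply tuples_spec|]. intros x hx.
  destruct (classic (exists x0, mem x0 x)) as [[x0 hx0]|n].
  - destruct (surjection_from_tuples hx hx0) as (a & p & f & ha & hp & hf).
    exists a. split; [exact ha|]. exists p. split; [exact hp|]. left. eauto.
  - destruct (well_order_exists Empty_set) as (R & wf & tri & trans).
    destruct (product_spec tuples (order_type wf)) as (p & hp).
    exists (order_type wf). split; [apply order_type_ord; assumption|].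
    exists p. split; [exact hp|]. right. split; [exact hx|]. intros z hz. eauto.
Qed.

(** * Failure of Collection *)

Lemma fresh (l : list nat) : exists d, ~ In d l.
Proof.
  exists (S (list_max l)). intro h.
  assert (k := proj1 (list_max_le l (list_max l)) (le_n _)).
  rewrite Forall_forall in k. apply k in h. lia.
Qed.

(** With variable 0 as [y] and variable 1 as [x]: [y] contains only urelements, and [x] injects
    into [y]. *)
Definition embeds_in_ur : form unit :=
  (AllIn 0 (zfu.Ur 0) ∧ Ex (zfu.injection 0 2 1))%form.

Lemma embeds_in_ur_bounded : bounded 2 embeds_in_ur.
Proof. cbn. repeat split; lia. Qed.

Lemma sat_embeds_in_ur r x y :
  sat (scons y (scons x r)) embeds_in_ur <->
  (forall z, mem z y -> ur z) /\ exists f, is_inj f x y.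
Proof. unfold embeds_in_ur. sem. reflexivity. Qed.

Lemma sat_collection_embeds r : sat r (collection 0 embeds_in_ur) <->
  forall w,
    (forall x, mem x w -> exists y, (forall z, mem z y -> ur z) /\ exists f, is_inj f x y) ->
    exists v, forall x, mem x w ->
      exists y, mem y v /\ (forall z, mem z y -> ur z) /\ exists f, is_inj f x y.
Proof.
  unfold collection. cbn [alls].
  assert (H1 : forall w x y, sat (scons y (scons x (scons w r))) (weaken 2 1 embeds_in_ur) <->
            (forall z, mem z y -> ur z) /\ exists f, is_inj f x y).
  { intros w x y. rewrite <- (sat_embeds_in_ur r). unfold weaken. rewrite holds_ren.
    apply holds_ext. intros [|[|i]]; reflexivity. }
  assert (H2 : forall w x y z,
            sat (scons y (scons x (scons z (scons w r)))) (weaken 2 2 embeds_in_ur) <->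
            (forall z, mem z y -> ur z) /\ exists f, is_inj f x y).
  { intros w x y z. rewrite <- (sat_embeds_in_ur r). unfold weaken. rewrite holds_ren.
    apply holds_ext. intros [|[|i]]; reflexivity. }
  apply all_sem. intro w. apply imp_sem.
  - apply AllIn_sem. intro x. apply ex_sem. intro y. apply H1.
  - apply ex_sem. intro v. apply AllIn_sem. intro x. apply ExIn_sem. intro y. apply H2.
Qed.

Section Blocks.
Context (lab : nat -> Idx) (lab_inj : forall k l, lab k = lab l -> k = l).

(** The [d]-th atom of the block [base], labelled by a plain atom to make it belong to the [k]-th
    copy. *)
Definition copy k d : V := pr (of_atom (Pln (lab k))) (of_atom (Blk base d)).

Lemma copy_inj k d l e : copy k d = copy l e -> k = l /\ d = e.
Proof.
  intro h. apply pr_inj in h. destruct h as [h1 h2].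
  apply of_atom_inj in h1. apply of_atom_inj in h2.
  split; [apply lab_inj|]; congruence.
Qed.

Lemma act_copy (g : perm) k d : fst g base = base -> act g (copy k d) = copy k (snd g d).
Proof. intro h. unfold copy. rewrite act_pr, !act_of_atom. cbn. rewrite h. reflexivity. Qed.

Definition copies n : V := collect (fun z => exists k d, k < n /\ z = copy k d).

Lemma fix_block (g : perm) i d : act g (of_atom (Blk i d)) = of_atom (Blk i d) -> fst g i = i.
Proof. rewrite act_of_atom. intro h. apply of_atom_inj in h. cbn in h. congruence. Qed.

Lemma small_double (P : nat -> Prop) (f : nat -> nat -> V) :
  is_small (fun z => exists k d, P k /\ z = f k d).
Proof.
  exists (nat * nat)%type, (fun c => f (fst c) (snd c)). intros z (k & d & _ & ->).
  exists (k, d). reflexivity.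
Qed.

Lemma copies_spec n :
  ~ ur (copies n) /\ forall z, mem z (copies n) <-> exists k d, k < n /\ z = copy k d.
Proof.
  apply (collect_spec (l := of_atom (Blk base 0) :: nil)); [apply small_double|].
  intros g hg z (k & d & hk & ->). exists k, (snd g d). split; [exact hk|].
  apply act_copy, (@fix_block _ _ 0), hg. left. reflexivity.
Qed.

Lemma act_copies (g : perm) n : fst g base = base -> act g (copies n) = copies n.
Proof.
  intro h. destruct (copies_spec n) as [h1 h2].
  assert (H : forall g : perm, fst g base = base ->
            forall z, mem z (copies n) -> mem (act g z) (copies n)).
  { intros k hk z hz. apply h2 in hz. destruct hz as (l & d & hl & ->).
    rewrite act_copy by exact hk. apply h2. eauto. }
  apply set_ext; rewrite ?act_ur; auto. intro z. rewrite mem_act. split; intro hz.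
  - apply (H g) in hz; [|exact h]. rewrite actVK in hz. exact hz.
  - apply H; [|exact hz]. cbn. rewrite <- h at 1. apply fwdK.
Qed.

(** The [k]-th copy goes to the block [lab k]; finitely many blocks are used, so the injection is
    in the model. *)
Lemma copies_inject n :
  exists y, (forall z, mem z y -> ur z) /\ exists f, is_inj f (copies n) y.
Proof.
  set (l := of_atom (Blk base 0) :: map (fun k => of_atom (Blk (lab k) 0)) (List.seq 0 n)).
  assert (hl : forall g, (forall x, In x l -> act g x = x) ->
            fst g base = base /\ forall k, k < n -> fst g (lab k) = lab k).
  { intros g hg. split.
    - apply (@fix_block _ _ 0), hg. left. reflexivity.
    - intros k hk. apply (@fix_block _ _ 0), hg. right. apply in_map_iff.
      exists k. split; [reflexivity|]. apply in_seq. lia. }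
  destruct (@collect_spec l (fun z => exists k d, k < n /\ z = of_atom (Blk (lab k) d))) as [_ hy].
  { apply small_double. }
  { intros g hg z (k & d & hk & ->). apply hl in hg. destruct hg as [_ hg].
    exists k, (snd g d). split; [exact hk|]. rewrite act_of_atom. cbn.
    rewrite hg by exact hk. reflexivity. }
  destruct (@collect_spec l
              (fun z => exists k d, k < n /\ z = pr (copy k d) (of_atom (Blk (lab k) d))))
    as [f_set hf].
  { apply small_double. }
  { intros g hg z (k & d & hk & ->). apply hl in hg. destruct hg as [hb hg].
    exists k, (snd g d). split; [exact hk|]. rewrite act_pr, act_copy, act_of_atom by exact hb. cbn.
    rewrite hg by exact hk. reflexivity. }
  set (y := collect _) in hy. set (f := collect _) in hf.
  exists y. split.
  { intros z hz. apply hy in hz. destruct hz as (k & d & _ & ->). apply of_atom_ur. }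
  assert (f_pair : forall k d c, k < n -> mem (pr (copy k d) c) f <-> c = of_atom (Blk (lab k) d)).
  { intros k d c hk. rewrite hf. split; [|intros ->; eauto].
    intros (k' & d' & _ & e). apply pr_inj in e. destruct e as [e ->].
    apply copy_inj in e. destruct e as [-> ->]. reflexivity. }
  exists f. split; [split; [exact f_set|split]|].
  - intros t ht. apply hf in ht. destruct ht as (k & d & hk & ->).
    exists (copy k d). split; [apply copies_spec; eauto|].
    exists (of_atom (Blk (lab k) d)). split; [apply hy; eauto|reflexivity].
  - intros a ha. apply copies_spec in ha. destruct ha as (k & d & hk & ->).
    exists (of_atom (Blk (lab k) d)). intro b. apply f_pair, hk.
  - intros a ha b hb c _ h1 h2. apply copies_spec in ha. apply copies_spec in hb.
    destruct ha as (k & d & hk & ->), hb as (k' & d' & hk' & ->).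
    apply f_pair in h1; [|exact hk]. apply f_pair in h2; [|exact hk'].
    rewrite h1 in h2. apply of_atom_inj in h2. injection h2 as e1 e2.
    apply lab_inj in e1. congruence.
Qed.

(** Take [d] outside a support of [f]. If the value of [f] at [copy k d] were not a [d]-th atom of
    a block, then the swap of [d] with a fresh [d'] would fix both [f] and this value, so [f] would
    take it at [copy k d'] too. *)
Lemma injection_diagonal n f y : (forall z, mem z y -> ur z) -> is_inj f (copies n) y ->
  exists d, forall k, k < n ->
    exists i, mem (of_atom (Blk i d)) y /\ mem (pr (copy k d) (of_atom (Blk i d))) f.
Proof.
  intros hy [(_ & f_prod & f_fun) f_inj].
  assert (hc : forall k d, k < n -> mem (copy k d) (copies n)).
  { intros; apply copies_spec; eauto. }
  destruct (finite_support f) as (K & E & hf). destruct (fresh E) as [d hd].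
  exists d. intros k hk.
  destruct (f_fun _ (hc k d hk)) as [c hcf].
  assert (cf : mem (pr (copy k d) c) f) by (apply hcf; reflexivity).
  assert (cy : mem c y).
  { destruct (f_prod _ cf) as (a & _ & b & hb & e). apply pr_inj in e.
    destruct e as [_ ->]. exact hb. }
  destruct (ur_of_atom (hy c cy)) as [b ->].
  assert (hb : exists i, b = Blk i d).
  { apply NNPP. intro hb.
    destruct (fresh (d :: match b with Blk _ e => e | Pln _ => 0 end :: E)) as [d' hd'].
    set (g := (idb Idx, swap d d') : perm).
    assert (hg : fixes K E g).
    { split; [reflexivity|]. intros e he. apply swap_other; [congruence|].
      intros ->. apply hd'. right. right. exact he. }
    assert (gb : act g (of_atom b) = of_atom b).
    { rewrite act_of_atom. f_equal. destruct b as [i e|j]; cbn; [|reflexivity]. f_equal.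
      apply swap_other; [intros ->; eauto|]. intros ->. apply hd'. right. left. reflexivity. }
    assert (h : mem (pr (copy k d') (of_atom b)) f).
    { rewrite <- (hf g hg).
      replace (pr (copy k d') (of_atom b)) with (act g (pr (copy k d) (of_atom b))).
      - apply act_mem, cf.
      - rewrite act_pr, gb, act_copy by reflexivity. cbn -[swap]. rewrite swap_l. reflexivity. }
    apply hd'. left.
    assert (e := f_inj _ (hc k d hk) _ (hc k d' hk) _ cy cf h). apply copy_inj in e. tauto. }
  destruct hb as [i ->]. eauto.
Qed.

(** For the [d] of [injection_diagonal], the [n] elements [copy k d] go to [d]-th elements of [n]
    distinct blocks, which all occur in [v]. *)
Lemma blocks_needed K E v n f y : supports K E v -> mem y v ->
  (forall z, mem z y -> ur z) -> is_inj f (copies n) y -> n <= length K.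
Proof.
  intros hv hyv hy hf. destruct (injection_diagonal hy hf) as [d hd].
  destruct hf as [_ f_inj].
  assert (H : forall m, m <= n -> exists l, NoDup l /\ length l = m /\ forall i, In i l ->
            exists k, k < m
              /\ mem (of_atom (Blk i d)) y /\ mem (pr (copy k d) (of_atom (Blk i d))) f).
  { induction m as [|m IH]; intro hm.
    - exists nil. repeat split; [constructor|]. intros i [].
    - destruct IH as (l & h1 & h2 & h3); [lia|]. destruct (hd m) as (i & hi & hif); [lia|].
      exists (i :: l). split; [constructor; [|exact h1]|split; [cbn; congruence|]].
      + intro hil. destruct (h3 i hil) as (k & hk & _ & hkf).
        assert (e : copy k d = copy m d).
        { apply (f_inj (copy k d)) with (of_atom (Blk i d)); auto; apply copies_spec;
            do 2 eexists; (split; [|reflexivity]); lia. }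
        apply copy_inj in e. lia.
      + intros j [<-|hj]; [exists m; auto|]. destruct (h3 j hj) as (k & hk & h). exists k.
        split; [lia|exact h]. }
  destruct (H n (le_n n)) as (l & h1 & h2 & h3). rewrite <- h2.
  apply NoDup_incl_length with (1 := h1). intros i hi. destruct (h3 i hi) as (k & _ & hk & _).
  apply (occ_support hv), occ_mem with (1 := hyv), occ_mem with (1 := hk). apply occ_at.
Qed.

End Blocks.

Lemma collection_embeds_fails r : ~ sat r (collection 0 embeds_in_ur).
Proof.
  destruct (Idx_embeds_small nat) as [lab lab_inj]. intro h.
  rewrite sat_collection_embeds in h.
  destruct (@collect_spec (of_atom (Blk base 0) :: nil) (fun x => exists n, x = copies lab n))
    as [_ hw].
  { apply small_range. }
  { intros g hg x [n ->]. exists n. apply act_copies, (@fix_block _ _ 0), hg. left. reflexivity. }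
  destruct (h (collect (fun x => exists n, x = copies lab n))) as [v hv].
  - intros x hx. apply hw in hx. destruct hx as [n ->]. apply copies_inject, lab_inj.
  - destruct (finite_support v) as (K & E & hK).
    destruct (hv (copies lab (S (length K)))) as (y & hyv & hy & f & hf); [apply hw; eauto|].
    assert (k := blocks_needed lab_inj hK hyv hy hf). lia.
Qed.

Theorem theorem4 :
  consistent ZF -> exists c, Collection c /\ ~ provable ZFU_Plenitude_SVC c.
Proof.
  intros _. exists (collection 0 embeds_in_ur). split.
  - constructor. apply embeds_in_ur_bounded.
  - intros (G & hG & h). apply (@collection_embeds_fails (fun _ => emp)).
    apply (soundness (E := mem) (U := fun _ => ur) h). intros b hb.
    destruct (hG b hb) as [a ha| |].
    + apply sat_ZFU, ha.
    + apply sat_plenitude.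
    + apply sat_svc.
Qed.
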